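(* Let $n\ge1$ and let $\beta<n+2$ be fixed. Let $\mathbf f\in\mathcal H^{s_1}(\mathbf T^n)$ and $\mathbf g\in\mathcal H^{s_2}(\mathbf T^n)$ with $s_1,s_2\in\mathbb{R}$. For $\delta>0$ and $t\ge0$ let $\mathbf U^{\delta,\beta}(t)\in\mathcal H^{s'}(\mathbf T^n)$, $s'=\min\{s_1,s_2+\max\{0,\frac{\beta-n}{2}\}\}$, be the solution of the peridynamic equation $\frac{d^2}{dt^2}\mathbf U=\mathcal L^{\delta,\beta}\mathbf U$, $\mathbf U(0)=\mathbf f$, $\frac{d}{dt}\mathbf U(0)=\mathbf g$, and let $\mathbf U^{\mathcal N}(t)\in\mathcal H^{s}(\mathbf T^n)$, $s=\min\{s_1,s_2+1\}$, be the solution of the Navier–Cauchy equation $\frac{d^2}{dt^2}\mathbf U^{\mathcal N}=\mathcal N\mathbf U^{\mathcal N}$, $\mathbf U^{\mathcal N}(0)=\mathbf f$, $\frac{d}{dt}\mathbf U^{\mathcal N}(0)=\mathbf g$. Then for each $t\ge0$, $$\lim_{\delta\to0^+}\mathbf U^{\delta,\beta}(t)=\mathbf U^{\mathcal N}(t)\quad\text{in }\mathcal H^{s'}(\mathbf T^n).$$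
   Context: Torus and spaces: $\mathbf T^n=\prod_{i=1}^n[0,2\pi]$ with periodic identification; a periodic vector distribution $\mathbf g$ is written $\mathbf g=\sum_{k\in\mathbb{Z}^n}\widehat{\mathbf g}_k e^{ik\cdot x}$ with $\widehat{\mathbf g}_k\in\mathbb{C}^n$. For $q\in\mathbb{R}$, $\mathcal H^q(\mathbf T^n)$ is the space of periodic vector distributions with $\|\mathbf g\|^2_{\mathcal H^q}=\sum_k(1+\|k\|^2)^q\|\widehat{\mathbf g}_k\|^2<\infty$. Multipliers: with ${}_pF_q(a_1,\dots,a_p;b_1,\dots,b_q;x)=\sum_{m\ge0}\frac{(a_1)_m\cdots(a_p)_m}{(b_1)_m\cdots(b_q)_m}\frac{x^m}{m!}$, where $(a)_m=a(a+1)\cdots(a+m-1)$, set for $\nu\in\mathbb{R}^n$ $$\lambda_1(\nu)=-\|\nu\|^2\Big(3\mu\,{}_3F_4\big(1,\tfrac52,\tfrac{n+2-\beta}{2};2,\tfrac32,\tfrac{n+4}{2},\tfrac{n+4-\beta}{2};-\tfrac14\|\nu\|^2\delta^2\big)+(\lambda^*-\mu)\,{}_1F_2\big(\tfrac{n+2-\beta}{2};\tfrac{n+2}{2},\tfrac{n+4-\beta}{2};-\tfrac14\|\nu\|^2\delta^2\big)^2\Big),$$ $$\lambda_2(\nu)=-\mu\|\nu\|^2\,{}_2F_3\big(1,\tfrac{n+2-\beta}{2};2,\tfrac{n+4}{2},\tfrac{n+4-\beta}{2};-\tfrac14\|\nu\|^2\delta^2\big).$$ $M_k$ ($k\in\mathbb{Z}^n$)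 is the real symmetric $n\times n$ matrix with $M_kk=\lambda_1(k)k$, $M_kw=\lambda_2(k)w$ for $w\perp k$, and $M_0=0$; $M^{\mathcal N}_k=-(\lambda^*+\mu)k\otimes k-\mu\|k\|^2I$. The peridynamic and Navier operators act by $\mathcal L^{\delta,\beta}\mathbf u=\sum_kM_k\widehat{\mathbf u}_ke^{ik\cdot x}$ and $\mathcal N\mathbf u=\sum_kM_k^{\mathcal N}\widehat{\mathbf u}_ke^{ik\cdot x}$ (i.e. $\mathcal N\mathbf u=(\lambda^*+\mu)\nabla(\nabla\cdot\mathbf u)+\mu\Delta\mathbf u$). Solutions: the solutions are given explicitly by $$\mathbf U^{\delta,\beta}(t)=(\widehat{\mathbf f}_0+\widehat{\mathbf g}_0t)+\sum_{0\ne k\in\mathbb{Z}^n}\left(\cos(\sqrt{-M_k}\,t)\widehat{\mathbf f}_k+\sin(\sqrt{-M_k}\,t)(\sqrt{-M_k})^{-1}\widehat{\mathbf g}_k\right)e^{ik\cdot x},$$ and $\mathbf U^{\mathcal N}(t)$ by the same formula with $M_k$ replaced by $M_k^{\mathcal N}$; functions of symmetric matrices are defined by functional calculus on eigenvalues. Standing assumption: the Lamé parameters satisfy $\mu>0$, $\lambda^*+2\mu>0$ (so $-M_k^{\mathcal N}$ is positive definite for $k\ne0$), and are such that $\lambda_1(\nu)<0$ for all $\nu\ne0$ and all parameter values under consideration (and $\lambda_2(\nu)<0$ for all $\nu\ne0$). *)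

(* Defs.v *)
From HB Require Import structures.
From mathcomp Require Import all_boot all_order all_algebra.
From mathcomp Require Import complex ring.
From mathcomp Require Import all_classical all_reals all_analysis.
Set Implicit Arguments.
Unset Strict Implicit.
Unset Printing Implicit Defensive.
Import Order.TTheory GRing.Theory Num.Theory.
Import numFieldNormedType.Exports.
Local Open Scope classical_set_scope.
Local Open Scope ring_scope.
Local Open Scope complex_scope.

Definition poch (R : realType) (a : R) (m : nat) : R := \prod_(i < m) (a + i%:R).

(* The generalized hypergeometric function pFq, with p = size a and q = size b. *)
Definition pFq (R : realType) (a b : seq R) (x : R) : R :=
  limn (series (fun m : nat =>
    (\prod_(c <- a) poch c m) / (\prod_(c <- b) poch c m) * (x ^+ m / m`!%:R))).

Definition nrm2 (R : realType) (n : nat) (v : 'cV[R]_n) : R := \sum_i v i 0 ^+ 2.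

Definition toR (R : realType) (n : nat) (k : 'cV[int]_n) : 'cV[R]_n :=
  map_mx (fun z : int => z%:~R) k.

Definition toC (R : realType) (m n : nat) (A : 'M[R]_(m, n)) : 'M[R[i]]_(m, n) :=
  map_mx (real_complex R) A.

Definition Cnrm2 (R : realType) (n : nat) (v : 'cV[R[i]]_n) : R :=
  \sum_i (complex.Re (v i 0) ^+ 2 + complex.Im (v i 0) ^+ 2).

(* A periodic vector distribution on T^n is represented by the family of its
   Fourier coefficients; membership in some H^q below forces the polynomial
   growth that characterizes the coefficients of a distribution. *)
Definition pdistr (R : realType) (n : nat) := 'cV[int]_n -> 'cV[R[i]]_n.

Definition Hnorm (R : realType) (n : nat) (q : R) (g : pdistr R n) : \bar R :=
  sqrte (\esum_(k in [set: 'cV[int]_n])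
           ((1 + nrm2 (toR R k)) `^ q * Cnrm2 (g k))%:E).

Definition inH (R : realType) (n : nat) (q : R) (g : pdistr R n) : Prop :=
  (Hnorm q g < +oo)%E.

Definition lambda1 (R : realType) (n : nat) (mu lam beta delta : R)
    (nu : 'cV[R]_n) : R :=
  let a := (n%:R + 2 - beta) / 2 in
  let b := (n%:R + 4 - beta) / 2 in
  let x := - (4^-1 * nrm2 nu * delta ^+ 2) in
  - nrm2 nu *
  (3 * mu * pFq [:: 1; 5 / 2; a] [:: 2; 3 / 2; (n%:R + 4) / 2; b] x
   + (lam - mu) * pFq [:: a] [:: (n%:R + 2) / 2; b] x ^+ 2).

Definition lambda2 (R : realType) (n : nat) (mu beta delta : R)
    (nu : 'cV[R]_n) : R :=
  let a := (n%:R + 2 - beta) / 2 in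
  let b := (n%:R + 4 - beta) / 2 in
  let x := - (4^-1 * nrm2 nu * delta ^+ 2) in
  - mu * nrm2 nu * pFq [:: 1; a] [:: 2; (n%:R + 4) / 2; b] x.

(* Characterized by the lemmas peri_mult_* below. For k = 0 the division by
   zero is harmless: lambda2 vanishes at 0, so that the multiplier is 0. *)
Definition peri_mult (R : realType) (n : nat) (mu lam beta delta : R)
    (k : 'cV[int]_n) : 'M[R]_n :=
  let v := toR R k in
  let P := (nrm2 v)^-1 *: (v *m v^T) in
  lambda1 mu lam beta delta v *: P + lambda2 mu beta delta v *: (1%:M - P).

Definition navier_mult (R : realType) (n : nat) (mu lam : R)
    (k : 'cV[int]_n) : 'M[R]_n :=
  let v := toR R k in
  - ((lam + mu) *: (v *m v^T)) - (mu * nrm2 v) *: 1%:M.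

Definition fourier_op (R : realType) (n : nat) (A : 'cV[int]_n -> 'M[R]_n)
  (u : pdistr R n) : pdistr R n := fun k => toC (A k) *m u k.

Definition peri_op (R : realType) (n : nat) (mu lam beta delta : R) :=
  fourier_op (@peri_mult R n mu lam beta delta).

Definition navier_op (R : realType) (n : nat) (mu lam : R) :=
  fourier_op (@navier_mult R n mu lam).

(* Functional calculus on the eigenvalues, meant for Hermitian matrices (whose
   eigenvalues are real); see mxfun_eigen. *)
Definition mxfun (R : realType) (n : nat) (h : R -> R) (A : 'M[R[i]]_n) :
    'M[R[i]]_n :=
  invmx (spectralmx A)
    *m diag_mx (map_mx (fun z => (h (complex.Re z))%:C) (spectral_diag A))
    *m spectralmx A.

(* The solution of U'' = (fourier_op A) U, U(0) = f, U'(0) = g; see peri_sol_ivp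
   and navier_sol_ivp. *)
Definition wave_sol (R : realType) (n : nat) (A : 'cV[int]_n -> 'M[R]_n)
    (f g : pdistr R n) (t : R) : pdistr R n := fun k =>
  if k == 0 then f k + t%:C *: g k
  else let S := mxfun Num.sqrt (toC (- A k)) in
    mxfun cos (t%:C *: S) *m f k + mxfun sin (t%:C *: S) *m invmx S *m g k.

Definition peri_sol (R : realType) (n : nat) (mu lam beta delta : R) :=
  wave_sol (@peri_mult R n mu lam beta delta).

Definition navier_sol (R : realType) (n : nat) (mu lam : R) :=
  wave_sol (@navier_mult R n mu lam).

Lemma peri_mult_sym (R : realType) (n : nat) (mu lam beta delta : R)
    (k : 'cV[int]_n) :
  (peri_mult mu lam beta delta k)^T = peri_mult mu lam beta delta k.
Proof.
apply/matrixP => i j; rewrite !mxE eq_sym; congr (_ * (_ * _) + _ * (_ - _ * _));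
  by apply: eq_bigr => l _; rewrite !mxE mulrC.
Qed.

Lemma nrm2E (R : realType) (n : nat) (v : 'cV[R]_n) : v^T *m v = (nrm2 v)%:M.
Proof.
apply/matrixP=> i j; rewrite !ord1 !mxE eqxx mulr1n /nrm2.
by apply: eq_bigr => l _; rewrite !mxE expr2.
Qed.

Lemma nrm2_eq0 (R : realType) (n : nat) (v : 'cV[R]_n) : nrm2 v = 0 -> v = 0.
Proof.
move=> /eqP; rewrite psumr_eq0 => [/allP h|i _]; last exact: sqr_ge0.
apply/colP => i; rewrite mxE; apply/eqP.
by have := h i (mem_index_enum _); rewrite sqrf_eq0.
Qed.

Lemma peri_mult_par (R : realType) (n : nat) (mu lam beta delta : R)
    (k : 'cV[int]_n) :
  peri_mult mu lam beta delta k *m toR R k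
  = lambda1 mu lam beta delta (toR R k) *: toR R k.
Proof.
rewrite /peri_mult; set v := toR R k.
have [v0|v0] := eqVneq (nrm2 v) 0; first by rewrite (nrm2_eq0 v0) mulmx0 scaler0.
have hP : ((nrm2 v)^-1 *: (v *m v^T)) *m v = v.
  by rewrite -scalemxAl -mulmxA nrm2E mul_mx_scalar scalerA mulVf ?scale1r.
by rewrite mulmxDl -[X in X + _]scalemxAl hP -scalemxAl mulmxBl mul1mx hP subrr
  scaler0 addr0.
Qed.

Lemma peri_mult_orth (R : realType) (n : nat) (mu lam beta delta : R)
    (k : 'cV[int]_n) (w : 'cV[R]_n) : (toR R k)^T *m w = 0 ->
  peri_mult mu lam beta delta k *m w = lambda2 mu beta delta (toR R k) *: w.
Proof.
move=> kw; rewrite /peri_mult mulmxDl -!scalemxAl mulmxBl mul1mx -scalemxAl.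
by rewrite -mulmxA kw mulmx0 !scaler0 subr0 add0r.
Qed.

Lemma peri_mult0 (R : realType) (n : nat) (mu lam beta delta : R) :
  peri_mult mu lam beta delta (0 : 'cV[int]_n) = 0.
Proof.
have h0 : toR R (0 : 'cV[int]_n) = 0 by apply/colP => i; rewrite !mxE.
have n0 : nrm2 (0 : 'cV[R]_n) = 0.
  by rewrite /nrm2 big1 // => i _; rewrite mxE expr0n.
by rewrite /peri_mult h0 /lambda1 /lambda2 n0 oppr0 !(mul0r, mulr0) !scale0r addr0.
Qed.

Lemma mxfun_eigen (R : realType) (n : nat) (h : R -> R) (A : 'M[R[i]]_n)
    (r : R) (v : 'cV[R[i]]_n) :
  A \is normalmx -> A *m v = r%:C *: v -> mxfun h A *m v = (h r)%:C *: v.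
Proof.
move=> /orthomx_spectralP Aeq Av; rewrite /mxfun.
have Pu := spectral_unit A.
set P := spectralmx A in Aeq Pu *; set d := spectral_diag A in Aeq *.
have Dw : diag_mx d *m (P *m v) = r%:C *: (P *m v).
  have := congr1 (mulmx P) Av.
  by rewrite {1}Aeq -!mulmxA mulKVmx // -scalemxAr.
suff Fw : diag_mx (map_mx (fun z => (h (complex.Re z))%:C) d) *m (P *m v)
    = (h r)%:C *: (P *m v).
  by rewrite -!mulmxA Fw -scalemxAr mulKmx.
apply/colP => i; have /colP/(_ i) := Dw.
rewrite !mul_diag_mx !mxE; set w := (\sum_j _).
have [->|w0] := eqVneq w 0; first by rewrite !mulr0.
by move=> /(mulIf w0) ->.
Qed.

Definition spmx (R : realType) (n : nat) (P : 'M[R[i]]_n) (e : 'rV[R]_n) :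
  'M[R[i]]_n := invmx P *m diag_mx (toC e) *m P.

Lemma spmx_mul (R : realType) (n : nat) (P : 'M[R[i]]_n) (e : 'rV[R]_n)
    (v : 'cV[R[i]]_n) i : (spmx P e *m v) i 0
  = \sum_j (e 0 j)%:C * (invmx P i j * (P *m v) j 0).
Proof.
rewrite /spmx -!mulmxA mxE; apply: eq_bigr => j _.
by rewrite mul_diag_mx mxE [toC e 0 j]mxE mulrCA.
Qed.

Lemma spmx_col (R : realType) (n : nat) (P : 'M[R[i]]_n) (e : 'rV[R]_n) j :
  P \in unitmx ->
  spmx P e *m (invmx P *m delta_mx j (0 : 'I_1))
  = (e 0 j)%:C *: (invmx P *m delta_mx j 0).
Proof.
move=> Pu; rewrite /spmx -!mulmxA (mulKVmx Pu) scalemxAr; apply: congr1.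
apply/colP => l; rewrite mul_diag_mx !mxE.
by have [->|] := eqVneq l j; rewrite // !mulr0.
Qed.

Lemma spmx_inj (R : realType) (n : nat) (P A B : 'M[R[i]]_n) :
  P \in unitmx ->
  (forall j, A *m (invmx P *m delta_mx j (0 : 'I_1))
             = B *m (invmx P *m delta_mx j 0)) -> A = B.
Proof.
move=> Pu AB; suff E : A *m invmx P = B *m invmx P.
  by rewrite -(mulmxKV Pu A) E mulmxKV.
apply/matrixP => i j; have /colP/(_ i) := AB j.
by rewrite !mulmxA -!colE !mxE.
Qed.

Lemma mxfun_spmx (R : realType) (n : nat) (h : R -> R) (P : 'M[R[i]]_n)
    (d : 'rV[R]_n) : P \is unitarymx ->
  mxfun h (spmx P d) = spmx P (map_mx h d).
Proof.
move=> Pun; have Pu := unitarymx_unit Pun.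
have An : spmx P d \is normalmx.
  by apply/orthomx_spectral_subproof; exists (P, toC d).
apply: (spmx_inj Pu) => j; rewrite (spmx_col _ _ Pu) mxE.
exact: mxfun_eigen An (spmx_col d j Pu).
Qed.

Lemma spmxM (R : realType) (n : nat) (P : 'M[R[i]]_n) (d e : 'rV[R]_n) :
  P \in unitmx -> spmx P d *m spmx P e = spmx P (\row_j (d 0 j * e 0 j)).
Proof.
move=> Pu; apply: (spmx_inj Pu) => j.
have hd := spmx_col d j Pu; have he := spmx_col e j Pu.
have hf := spmx_col (\row_j (d 0 j * e 0 j)) j Pu.
by rewrite hf -mulmxA [X in _ *m X]he -scalemxAr hd scalerA mxE rmorphM mulrC.
Qed.

Lemma spmxZ (R : realType) (n : nat) (P : 'M[R[i]]_n) (r : R) (e : 'rV[R]_n) :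
  P \in unitmx -> r%:C *: spmx P e = spmx P (r *: e).
Proof.
move=> Pu; apply: (spmx_inj Pu) => j.
have he := spmx_col e j Pu; have hf := spmx_col (r *: e) j Pu.
by rewrite hf -scalemxAl he scalerA mxE rmorphM.
Qed.

Lemma spmx1 (R : realType) (n : nat) (P : 'M[R[i]]_n) :
  P \in unitmx -> spmx P (\row_j 1) = 1%:M.
Proof.
by move=> Pu; apply: (spmx_inj Pu) => j; rewrite (spmx_col _ _ Pu) mxE scale1r mul1mx.
Qed.

Lemma sym_diag (R : realType) (n : nat) (A : 'M[R]_n) :
  A^T = A ->
  exists2 P : 'M[R[i]]_n, P \is unitarymx &
  exists d : 'rV[R]_n, toC A = spmx P d.
Proof.
move=> As; have Ah : toC A \is hermsymmx.
  apply: realsym_hermsym.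
    apply/is_hermitianmxP; rewrite expr0 scale1r; apply/matrixP => i j.
    by rewrite !mxE; have /matrixP/(_ i j) := As; rewrite mxE => ->.
  apply/mxOverP => i j; rewrite mxE; apply/CrealP.
  by rewrite -[RHS]/(A i j)%:C; apply/eqP; rewrite eq_complex /= oppr0 !eqxx.
exists (spectralmx (toC A)); first exact: spectral_unitarymx.
exists (map_mx (@complex.Re R) (spectral_diag (toC A))).
have /orthomx_spectralP {1}-> := hermitian_normalmx Ah.
rewrite /spmx; suff -> : toC (map_mx (@complex.Re R) (spectral_diag (toC A)))
  = spectral_diag (toC A) by [].
apply/rowP => j; rewrite !mxE.
have /mxOverP/(_ 0 j)/CrealP := hermitian_spectral_diag_real Ah.
case: (spectral_diag _ 0 j) => a b /eqP; rewrite eq_complex /= eqxx /= => hb.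
congr (_ +i* _)%C; apply/esym/eqP; rewrite -[b == 0](@mulrn_eq0 _ b 2) mulr2n.
by rewrite -{1}(eqP hb) addNr.
Qed.

Lemma sym_eig (R : realType) (n : nat) (A : 'M[R]_n) (r : R) (v : 'cV[R[i]]_n) :
  v != 0 -> toC A *m v = r%:C *: v ->
  exists2 w : 'cV[R]_n, w != 0 & A *m w = r *: w.
Proof.
move=> v0 Av; set x := map_mx (@complex.Re R) v; set y := map_mx (@complex.Im R) v.
have sumRe (F : 'I_n -> R[i]) : complex.Re (\sum_j F j) = \sum_j complex.Re (F j).
  by apply: (big_morph (@complex.Re R)) => //; case=> ? ? [].
have sumIm (F : 'I_n -> R[i]) : complex.Im (\sum_j F j) = \sum_j complex.Im (F j).
  by apply: (big_morph (@complex.Im R)) => //; case=> ? ? [].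
have xE : A *m x = r *: x.
  apply/colP => i; have /colP/(_ i)/(congr1 (@complex.Re R)) := Av.
  rewrite !mxE sumRe => h; transitivity (complex.Re (r%:C * v i 0)).
    rewrite -h; apply: eq_bigr => j _; rewrite !mxE.
    by case: (v j 0) => a b /=; rewrite mul0r subr0.
  by case: (v i 0) => a b /=; rewrite mul0r subr0.
have yE : A *m y = r *: y.
  apply/colP => i; have /colP/(_ i)/(congr1 (@complex.Im R)) := Av.
  rewrite !mxE sumIm => h; transitivity (complex.Im (r%:C * v i 0)).
    rewrite -h; apply: eq_bigr => j _; rewrite !mxE.
    by case: (v j 0) => a b /=; rewrite mul0r addr0.
  by case: (v i 0) => a b /=; rewrite mul0r addr0.
have [x0|x0] := eqVneq x 0; last by exists x.
have [y0|y0] := eqVneq y 0; last by exists y.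
case/eqP: v0; apply/colP => i; have /colP/(_ i) := x0; have /colP/(_ i) := y0.
by rewrite !mxE; case: (v i 0) => a b /= -> ->.
Qed.

(* p stands for the real or the imaginary part: each real component u of each
   Fourier coefficient has derivative v, with v' = (fourier_op A U)_k. *)
Definition wave_ivp (R : realType) (n : nat) (L : pdistr R n -> pdistr R n)
    (f g : pdistr R n) (U : R -> pdistr R n) : Prop :=
  forall (k : 'cV[int]_n) (i : 'I_n) (p : R[i] -> R),
    p = @complex.Re R \/ p = @complex.Im R ->
  exists v : R -> R,
    [/\ p (U 0 k i 0) = p (f k i 0), v 0 = p (g k i 0),
        forall t : R, is_derive t 1 (fun t => p (U t k i 0)) (v t)
      & forall t : R, is_derive t 1 v (p (L (U t) k i 0))].

Lemma is_derive_trig (R : realType) (w a b t : R) :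
  is_derive t 1 (fun t => cos (t * w) * a + sin (t * w) * b)
    (cos (t * w) * (w * b) + sin (t * w) * (- w * a)).
Proof.
have hl : is_derive t 1 (fun t : R => t * w) w.
  have -> : (fun t : R => t * w) = (w \*: id) by apply/funext => x /=; rewrite mulrC.
  by apply: is_derive_eq; rewrite /GRing.scale /= mulr1.
have hc : is_derive t 1 (fun t : R => cos (t * w)) (- sin (t * w) * w).
  have := @is_derive1_comp R cos (fun t : R => t * w) t _ _ (is_derive_cos _) hl.
  by [].
have hs : is_derive t 1 (fun t : R => sin (t * w)) (cos (t * w) * w).
  have := @is_derive1_comp R sin (fun t : R => t * w) t _ _ (is_derive_sin _) hl.
  by [].
have -> : (fun t => cos (t * w) * a + sin (t * w) * b)
    = (a \*: (fun t => cos (t * w))) + (b \*: (fun t => sin (t * w))).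
  by apply/funext => x; rewrite -[RHS]/(a * _ + b * _) mulrC (mulrC b).
apply: is_derive_eq; rewrite /GRing.scale /= addrC; congr (_ + _).
  by rewrite mulrCA (mulrC b).
by rewrite mulNr mulrN mulrCA mulNr mulrN (mulrC a).
Qed.

Lemma wave_sol_ivp (R : realType) (n : nat) (A : 'cV[int]_n -> 'M[R]_n)
    (f g : pdistr R n) :
  A 0 = 0 -> (forall k, (A k)^T = A k) ->
  (forall k r (w : 'cV[R]_n), k != 0 -> w != 0 -> A k *m w = r *: w -> r < 0) ->
  wave_ivp (fourier_op A) f g (wave_sol A f g).
Proof.
move=> A0 As Aneg k i p hp.
have pD : {morph p : x y / x + y >-> x + y} by case: hp => -> [a b] [c d].
have p0 : p 0 = 0 by case: hp => ->.
have pZ (r : R) z : p (r%:C * z) = r * p z.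
  by case: hp => ->; case: z => a b /=; rewrite mul0r ?subr0 ?addr0.
have psum (F : 'I_n -> R[i]) : p (\sum_j F j) = \sum_j p (F j) by exact: big_morph.
have [->|k0] := eqVneq k 0.
  exists (fun=> p (g 0 i 0)); rewrite /wave_sol /fourier_op eqxx.
  have uE : (fun t => p ((f 0 + t%:C *: g 0) i 0))
      = (fun t => p (f 0 i 0) + t * p (g 0 i 0)).
    by apply/funext => t; rewrite !mxE pD pZ.
  split=> //.
  - by rewrite !mxE mul0r addr0.
  - move=> t; rewrite uE.
    have -> : (fun t => p (f 0 i 0) + t * p (g 0 i 0))
        = cst (p (f 0 i 0)) + (p (g 0 i 0) \*: id).
      by apply/funext => x; rewrite -[RHS]/(_ + _ * x) (mulrC x).
    by apply: is_derive_eq; rewrite add0r /GRing.scale /= mulr1.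
  - move=> t; suff -> : p ((toC (A 0) *m (f 0 + t%:C *: g 0)) i 0) = 0.
      exact: is_derive_cst.
    by rewrite mxE big1 // => j _; rewrite A0 !mxE mul0r.
have [P Pun [d Bd]] : exists2 P : 'M[R[i]]_n, P \is unitarymx &
    exists d : 'rV[R]_n, toC (- A k) = spmx P d.
  by apply: sym_diag; rewrite linearN /= As.
have Pu := unitarymx_unit Pun.
have dpos j : 0 < d 0 j.
  have v0 : invmx P *m delta_mx j (0 : 'I_1) != 0.
    apply/eqP => /(congr1 (mulmx P)); rewrite (mulKVmx Pu) mulmx0.
    by move=> /colP/(_ j)/eqP; rewrite !mxE !eqxx oner_eq0.
  have := spmx_col d j Pu; rewrite -Bd.
  move=> /(sym_eig v0)[w w0 /eqP]; rewrite mulNmx eqr_oppLR -scaleNr => /eqP Aw.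
  by rewrite -oppr_lt0; exact: Aneg k0 w0 Aw.
have Fp e (v : 'cV[R[i]]_n) : p ((spmx P e *m v) i 0)
    = \sum_j e 0 j * p (invmx P i j * (P *m v) j 0).
  by rewrite spmx_mul psum; apply: eq_bigr => j _; rewrite pZ.
have rowE (h : 'I_n -> R) j : (\row_j h j) 0 j = h j by rewrite mxE.
pose w := map_mx Num.sqrt d.
have wpos j : 0 < w 0 j by rewrite mxE sqrtr_gt0.
have wne j : w 0 j != 0 by rewrite gt_eqF.
have wd j : w 0 j * w 0 j = d 0 j by rewrite !mxE -expr2 sqr_sqrtr // ltW.
have SE : mxfun Num.sqrt (toC (- A k)) = spmx P w by rewrite Bd; exact: mxfun_spmx.
clearbody w.
have tS (t : R) (h : R -> R) :
    mxfun h (t%:C *: spmx P w) = spmx P (\row_j h (t * w 0 j)).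
  rewrite (spmxZ _ _ Pu) (mxfun_spmx _ _ Pun); apply: congr1.
  by apply/rowP => j; rewrite !mxE.
have Sinv : invmx (spmx P w) = spmx P (\row_j (w 0 j)^-1).
  have E : spmx P w *m spmx P (\row_j (w 0 j)^-1) = 1%:M.
    rewrite (spmxM _ _ Pu) -(spmx1 Pu); apply: congr1.
    by apply/rowP => j; rewrite !mxE divff.
  have [Fu _] := mulmx1_unit E.
  by rewrite -[RHS](mulKmx Fu) E mulmx1.
pose a j := p (invmx P i j * (P *m f k) j 0).
pose b j := p (invmx P i j * (P *m g k) j 0).
pose c t j := cos (t * w 0 j); pose s t j := sin (t * w 0 j).
have UE t : wave_sol A f g t k
    = spmx P (\row_j c t j) *m f k + spmx P (\row_j (s t j / w 0 j)) *m g k.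
  rewrite /wave_sol (negbTE k0) SE !tS Sinv (spmxM _ _ Pu).
  suff -> : \row_j ((\row_j sin (t * w 0 j)) 0 j * (\row_j (w 0 j)^-1) 0 j)
    = \row_j (s t j / w 0 j) by [].
  by apply/rowP => j; rewrite !mxE.
have uE t : p (wave_sol A f g t k i 0)
    = \sum_j (c t j * a j + s t j / w 0 j * b j).
  rewrite UE mxE pD !Fp -big_split /=.
  by apply: eq_bigr => j _; rewrite !rowE.
have AE : toC (A k) = spmx P (- 1 *: d).
  rewrite -(spmxZ _ _ Pu) -Bd; apply/matrixP => x y.
  by rewrite !mxE -rmorphM mulN1r opprK.
have LE t : p (fourier_op A (wave_sol A f g t) k i 0)
    = \sum_j - d 0 j * (c t j * a j + s t j / w 0 j * b j).
  have FA e (x : 'cV[R[i]]_n) : spmx P (- 1 *: d) *m (spmx P e *m x)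
      = spmx P (\row_j ((- 1 *: d) 0 j * e 0 j)) *m x.
    by rewrite -(spmxM _ _ Pu) -[RHS]mulmxA.
  rewrite /fourier_op UE AE.
  rewrite mulmxDr.
  rewrite [X in X + _]FA [X in _ + X]FA.
  rewrite mxE pD.
  rewrite !Fp -big_split /=.
  by apply: eq_bigr => j _; rewrite !rowE [(- 1 *: d) 0 j]mxE mulN1r mulrDr !mulrA.
exists (fun t => \sum_j (- (w 0 j) * s t j * a j + c t j * b j)); split.
- have -> : p (f k i 0) = p ((spmx P (\row_j 1) *m f k) i 0) by rewrite (spmx1 Pu) mul1mx.
  rewrite uE Fp; apply: eq_bigr => j _.
  by rewrite /c /s mul0r cos0 sin0 !mul0r addr0 rowE.
- have -> : p (g k i 0) = p ((spmx P (\row_j 1) *m g k) i 0) by rewrite (spmx1 Pu) mul1mx.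
  rewrite Fp; apply: eq_bigr => j _.
  by rewrite /c /s mul0r cos0 sin0 mulr0 mul0r add0r rowE mul1r.
- move=> t; under eq_fun do rewrite uE.
  rewrite -fct_sumE; apply: is_derive_sum => j.
  have -> : (fun t => c t j * a j + s t j / w 0 j * b j)
      = (fun t => cos (t * w 0 j) * a j + sin (t * w 0 j) * (b j / w 0 j)).
    by apply/funext => x; rewrite mulrAC -mulrA.
  apply: (is_derive_eq (is_derive_trig _ _ _ _)).
  by rewrite addrC mulrCA mulrA (mulrC (w 0 j)) divfK.
- move=> t; rewrite LE -fct_sumE; apply: is_derive_sum => j.
  have -> : (fun t => - w 0 j * s t j * a j + c t j * b j)
      = (fun t => cos (t * w 0 j) * b j + sin (t * w 0 j) * (- w 0 j * a j)).
    by apply/funext => x; rewrite addrC [X in _ = _ + X]mulrCA mulrA.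
  apply: (is_derive_eq (is_derive_trig _ _ _ _)).
  rewrite -wd -/(c t j) -/(s t j); have := wne j; set r := w 0 j => r0; field.
  by [].
Qed.

Lemma peri_sol_ivp (R : realType) (n : nat) (mu lam beta delta : R)
    (f g : pdistr R n) :
  (forall nu : 'cV[R]_n, nu != 0 -> lambda1 mu lam beta delta nu < 0) ->
  (forall nu : 'cV[R]_n, nu != 0 -> lambda2 mu beta delta nu < 0) ->
  wave_ivp (peri_op mu lam beta delta) f g (peri_sol mu lam beta delta f g).
Proof.
move=> l1 l2; apply: wave_sol_ivp; [exact: peri_mult0|exact: peri_mult_sym|].
move=> k r w k0 w0 Mw.
have v0 : toR R k != 0.
  apply: contra_neq k0 => /colP v0; apply/colP => i; apply/eqP.
  by have /eqP := v0 i; rewrite !mxE intr_eq0.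
have kM : (toR R k)^T *m (peri_mult mu lam beta delta k *m w)
    = lambda1 mu lam beta delta (toR R k) *: ((toR R k)^T *m w).
  rewrite mulmxA -{1}(peri_mult_sym mu lam beta delta k) -trmx_mul.
  by rewrite peri_mult_par linearZ /= -scalemxAl.
have [kw|kw] := eqVneq ((toR R k)^T *m w) 0.
  have := peri_mult_orth mu lam beta delta kw; rewrite Mw => /eqP.
  rewrite -subr_eq0 -scalerBl scaler_eq0 (negbTE w0) orbF subr_eq0 => /eqP ->.
  exact: l2.
move: kM; rewrite Mw -scalemxAr => /eqP.
rewrite -subr_eq0 -scalerBl scaler_eq0 (negbTE kw) orbF subr_eq0 => /eqP ->.
exact: l1.
Qed.

Lemma navier_sol_ivp (R : realType) (n : nat) (mu lam : R) (f g : pdistr R n) :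
  0 < mu -> 0 < lam + 2 * mu ->
  wave_ivp (navier_op mu lam) f g (navier_sol mu lam f g).
Proof.
move=> mu0 lm0; apply: wave_sol_ivp.
- apply/matrixP => i j; rewrite !mxE big1 => [|l _]; last by rewrite !mxE mul0r.
  rewrite /nrm2 big1 => [|l _]; last by rewrite !mxE expr0n.
  by rewrite !mulr0 mul0r subr0 oppr0.
- move=> k; apply/matrixP => i j; rewrite !mxE eq_sym; congr (- (_ * _) - _).
  by apply: eq_bigr => l _; rewrite !mxE mulrC.
- move=> k r w k0 w0; rewrite /navier_mult; set v := toR R k => Mw.
  have v0 : nrm2 v != 0.
    apply: contra_neq k0 => /nrm2_eq0/colP v0; apply/colP => i; apply/eqP.
    by have /eqP := v0 i; rewrite !mxE intr_eq0.
  have vpos : 0 < nrm2 v.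
    by rewrite lt_def v0 sumr_ge0 // => i _; exact: sqr_ge0.
  have ME : (- ((lam + mu) *: (v *m v^T)) - (mu * nrm2 v) *: 1%:M) *m w
      = - (lam + mu) *: (v *m (v^T *m w)) - (mu * nrm2 v) *: w.
    by rewrite mulmxBl -scaleNr -!scalemxAl mul1mx mulmxA.
  rewrite ME in Mw; have [kw|kw] := eqVneq (v^T *m w) 0.
    move: Mw; rewrite kw mulmx0 scaler0 sub0r -scaleNr => /eqP.
    rewrite -subr_eq0 -scalerBl scaler_eq0 (negbTE w0) orbF subr_eq0 => /eqP <-.
    by rewrite oppr_lt0 mulr_gt0.
  have := congr1 (mulmx v^T) Mw.
  rewrite mulmxBr -!scalemxAr (mulmxA v^T v) nrm2E mul_scalar_mx scalerA -scalerBl => /eqP.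
  rewrite -subr_eq0 -scalerBl scaler_eq0 (negbTE kw) orbF subr_eq0 => /eqP <-.
  by rewrite -mulrBl pmulr_llt0 // -opprD oppr_lt0 -addrA -mulr2n -mulr_natl.
Qed.

(* Main.v *)
Require Import Defs.
From mathcomp Require Import all_boot all_order all_algebra.
From mathcomp Require Import finmap complex ring lra.
From mathcomp Require Import all_classical all_reals all_analysis.
Set Implicit Arguments.
Unset Strict Implicit.
Unset Printing Implicit Defensive.
Import Order.TTheory GRing.Theory Num.Theory.
Import numFieldNormedType.Exports.
Local Open Scope classical_set_scope.
Local Open Scope ring_scope.

(** Why the theorem is true.  Put y = |k|^2 delta^2 / 4, a = (n + 2 - beta) / 2
    and b = (n + 2) / 2.  The eigenvalues of the peridynamic multiplier at k are
    lambda_i = - |k|^2 m_i(y), where the profiles m_1 (dilation) and m_2 (shear)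
    are entire in y with m_1(0) = lam + 2 mu and m_2(0) = mu; the Navier
    multiplier has eigenvalues - |k|^2 m_i(0).  Both multipliers are combinations
    of the projection P onto the line of k and of 1 - P, so each nonzero Fourier
    mode of either solution is
      (cos_1 P + cos_2 (1 - P)) f_k + (sin_1 P + sin_2 (1 - P)) g_k
    with the scalar factors cos (t sqrt r) and sin (t sqrt r) / sqrt r taken at
    r = - lambda_i ([wave_sol_proj]).  As delta tends to 0, y tends to 0 and every
    mode converges ([wave_sol_cvg]).  What remains is to dominate the modes
    uniformly in small delta ([Hterm_wave_sol]), and then to sum
    ([esum_dominated_small]).

    Domination asks for |sin (t sqrt r) / sqrt r|^2 <= C (1 + |k|^2)^(-p), with
    p = max 0 ((beta - n) / 2).  If beta <= n then p = 0 and the bound t^2 is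
    enough.  If beta > n then 0 < a < 1 and p = 1 - a, and since the left-hand side
    is at most 1 / r it suffices that m_i(y) >= c (1 + y)^(-a) for all y >= 0
    ([profile_coercive]).  Compactness handles bounded y, as the profiles are
    continuous and positive; only their size as y tends to infinity matters.

    That size is found without any asymptotic expansion.  A pair (a; a + 1) of
    hypergeometric parameters turns a series G into the average
    M(y) = a int_0^1 s^(a-1) G(s y) ds, that is,
    (y^a M(y))' = a y^(a-1) G(y) ([is_derive_powR_avg]).  All the functions G that
    occur come from J = 0F1(; b; -y), a solution of y J'' + b J' + J = 0.
    Two energies of this equation are nonincreasing; they give J^2 <= 1
    ([bessel_le1]) and 4 y J^2 <= 2 b - 2 ([bessel_decay]).
    - The shear profile is mu times the average of b (1 - J) / y, which is
      nonnegative by the first bound; so y^a m_2(y) is nondecreasing and stays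
      above its value at 1.
    - The dilation profile is 3 mu A + (lam - mu) B^2, where A is at least one
      third of the shear average and B is the average of J.  By the second bound
      y^a B = O(y^(a^2/2)), hence y^a B^2 = O(y^(a^2-a)) tends to 0, and the B
      term cannot spoil the lower bound coming from A. *)

(** * Power series with factorially small coefficients *)

Definition pssum (R : realType) (c : nat -> R) (y : R) : R := limn (pseries c y).

(** This class of coefficients is closed under [pseries_diffs] with the same
    constant 1, so that its members are entire and can be differentiated freely. *)
Definition fact_bounded (R : realType) (c : nat -> R) :=
  forall m, `|c m| <= (m`!%:R)^-1.

Lemma fact_bounded_diffs (R : realType) (c : nat -> R) :
  fact_bounded c -> fact_bounded (pseries_diffs c).
Proof.
move=> hc m; rewrite /pseries_diffs normrM normr_nat.
apply: (le_trans (ler_wpM2l _ (hc m.+1))); first exact: ler0n.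
by rewrite factS natrM invfM mulVKf // pnatr_eq0.
Qed.

Lemma pseries_bounded_cvg (R : realType) (c : nat -> R) (y : R) :
  fact_bounded c -> cvgn (pseries c y).
Proof.
move=> hc; apply: normed_cvg.
apply: (@series_le_cvg _ _ (exp_coeff `|y|)) => [m|m|m|].
- exact: normr_ge0.
- by rewrite /exp_coeff mulr_ge0 ?invr_ge0 ?exprn_ge0.
- rewrite -[leLHS]/`|c m * y ^+ m|.
  by rewrite normrM normrX /exp_coeff /= [leRHS]mulrC ler_wpM2r // exprn_ge0.
- exact: is_cvg_series_exp_coeff.
Qed.

Lemma is_derive_pssum (R : realType) (c : nat -> R) (y : R) :
  fact_bounded c -> is_derive y 1 (pssum c) (pssum (pseries_diffs c) y).
Proof.
move=> hc; have hd := fact_bounded_diffs hc.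
apply: (@pseries_snd_diffs _ c (`|y| + 1)).
- exact: pseries_bounded_cvg.
- exact: pseries_bounded_cvg.
- exact/pseries_bounded_cvg/fact_bounded_diffs.
- by rewrite [ltRHS]ger0_norm ?ltrDl // addr_ge0.
Qed.

Lemma pssum0 (R : realType) (c : nat -> R) : pssum c 0 = c 0.
Proof.
apply/cvg_lim => //; rewrite -(cvg_shiftn 1) /=.
apply: cvg_near_cst; near=> m.
rewrite addn1 /pseries /series /= big_nat_recl //= expr0 mulr1 big1 ?addr0 //.
by move=> i _; rewrite expr0n mulr0.
Unshelve. all: by end_near.
Qed.

(** Convergence is assumed of the two series only; this makes the lemma apply to
    [fun m => m%:R * c m], which need not be [fact_bounded]. *)
Lemma pssum_lin (R : realType) (c d : nat -> R) (p q y : R) :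
  cvgn (pseries c y) -> cvgn (pseries d y) ->
  pssum (fun m => p * c m + q * d m) y = p * pssum c y + q * pssum d y.
Proof.
move=> hc hd; apply/cvg_lim => //.
have -> : pseries (fun m => p * c m + q * d m) y
  = p \*: pseries c y + q \*: pseries d y.
  apply/funext => m; rewrite /pseries /series /= -[RHS]/(p * _ + q * _).
  rewrite !mulr_sumr -big_split /=.
  by apply: eq_bigr => i _; rewrite mulrDl !mulrA.
by apply: cvgD; apply: cvgZr.
Qed.

Lemma pseries_shift_cvg (R : realType) (c : nat -> R) (y : R) :
  cvgn (pseries (fun m => c m.+1) y) ->
  pseries c y @ \oo --> c 0 + y * pssum (fun m => c m.+1) y.
Proof.
move=> hc; rewrite -(cvg_shiftn 1) /=.
have -> : (fun m => pseries c y (m + 1)%N)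
  = cst (c 0) + y \*: pseries (fun m => c m.+1) y.
  apply/funext => m; rewrite /pseries /series /= -[RHS]/(_ + y * _).
  rewrite addn1 big_nat_recl //= expr0 mulr1 mulr_sumr; congr (_ + _).
  by apply: eq_bigr => i _; rewrite exprS; ring.
by apply: cvgD; [exact: cvg_cst|exact: cvgZr].
Qed.

Lemma pseries_euler_cvg (R : realType) (c : nat -> R) (y : R) : fact_bounded c ->
  pseries (fun m => m%:R * c m) y @ \oo --> y * pssum (pseries_diffs c) y.
Proof.
move=> hc; have := @pseries_shift_cvg _ (fun m => m%:R * c m) y.
by rewrite mul0r add0r; apply; exact/pseries_bounded_cvg/fact_bounded_diffs.
Qed.

(** A first-order equation y F' + p F = q G between power series amounts to the
    relation (m + p) c_m = q d_m between coefficients.  Every differential equation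
    below, including the second-order one, is obtained in this way. *)
Lemma pssum_euler (R : realType) (c d : nat -> R) (p q y : R) :
  fact_bounded c -> fact_bounded d ->
  (forall m, m%:R * c m + p * c m = q * d m) ->
  y * pssum (pseries_diffs c) y + p * pssum c y = q * pssum d y.
Proof.
move=> hc hd h; have hE := @pseries_euler_cvg _ c y hc.
have := @pssum_lin _ (fun m => m%:R * c m) c 1 p y (cvgP _ hE)
  (pseries_bounded_cvg hc).
have -> : (fun m => 1 * (m%:R * c m) + p * c m) = (fun m => q * d m + 0 * d m).
  by apply/funext => m; rewrite mul1r h mul0r addr0.
rewrite pssum_lin ?mul0r ?addr0 ?mul1r; [|exact: pseries_bounded_cvg..] => ->.
by rewrite /pssum (cvg_lim _ hE).
Qed.

Lemma is_derive_ge0_le (R : realType) (f df : R -> R) (a b : R) : a <= b ->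
  (forall x, a <= x <= b -> is_derive x 1 f (df x)) ->
  (forall x, a <= x <= b -> 0 <= df x) -> f a <= f b.
Proof.
move=> ab fd df0.
have [x|x|c cab fba] := @MVT_segment R f df a b ab.
- by rewrite in_itv /= => /andP[ax xb]; apply: fd; rewrite !ltW.
- apply: derivable_within_continuous => z; rewrite in_itv /= => zab.
  by case: (fd z zab).
- rewrite -subr_ge0 fba mulr_ge0 ?subr_ge0 //.
  by apply: df0; move: cab; rewrite in_itv.
Qed.

Lemma fact_bounded_shift (R : realType) (c : nat -> R) :
  fact_bounded c -> fact_bounded (fun m => c m.+1).
Proof.
move=> hc m; apply: le_trans (hc m.+1) _.
by rewrite lef_pV2 ?posrE ?ltr0n ?fact_gt0 // ler_nat factS leq_pmull.
Qed.

(** * Averages of Bessel-type series *)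

Lemma pochS (R : realType) (c : R) m : poch c m.+1 = poch c m * (c + m%:R).
Proof. by rewrite /poch big_ord_recr. Qed.

Lemma pochSl (R : realType) (c : R) m : poch c m.+1 = c * poch (c + 1) m.
Proof.
rewrite /poch big_ord_recl addr0; congr (_ * _); apply: eq_bigr => i _.
by rewrite -addrA /= /bump add1n -natr1 (addrC 1).
Qed.

Lemma poch_gt0 (R : realType) (c : R) m : 0 < c -> 0 < poch c m.
Proof. by move=> c0; apply: prodr_gt0 => i _; rewrite ltr_wpDr. Qed.

Lemma poch_ge1 (R : realType) (c : R) m : 1 <= c -> 1 <= poch c m.
Proof.
move=> c1; elim: m => [|m IH]; first by rewrite /poch big_ord0.
by rewrite pochS mulr_ege1 // ler_wpDr.
Qed.

Lemma poch1 (R : realType) m : poch (1 : R) m = m`!%:R.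
Proof.
elim: m => [|m IH]; first by rewrite /poch big_ord0.
by rewrite pochS IH factS natrM mulrC -natr1 (addrC 1).
Qed.

Lemma poch2 (R : realType) m : poch (2 : R) m = m.+1`!%:R.
Proof. by rewrite -poch1 pochSl mul1r. Qed.

Lemma poch_shift1 (R : realType) (c : R) m : 0 < c ->
  poch (c + 1) m = (c + m%:R) / c * poch c m.
Proof.
move=> c0; apply: (mulfI (lt0r_neq0 c0)).
by rewrite -pochSl pochS; field; rewrite lt0r_neq0.
Qed.

(** Coefficients in y of 0F1(; b; -y); up to the factor u^(b-1) and a constant, this
    is the Bessel function of order b - 1 at u = 2 sqrt y. *)
Definition bessel_coef (R : realType) (b : R) (m : nat) : R :=
  (-1) ^+ m / (m`!%:R * poch b m).

(** Coefficients in y of 1F2(1; 2, b + 1; -y), which is b (1 - 0F1(; b; -y)) / y;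
    see [defect_bessel]. *)
Definition defect_coef (R : realType) (b : R) (m : nat) : R :=
  (-1) ^+ m / (m.+1`!%:R * poch (b + 1) m).

(** Adding the pair (a; a + 1) of hypergeometric parameters multiplies the m-th
    coefficient by a / (a + m) = a int_0^1 s^(a-1) s^m ds: the sum becomes the
    average a int_0^1 s^(a-1) F(s y) ds of the original sum F. *)
Definition avg_coef (R : realType) (a : R) (c : nat -> R) (m : nat) : R :=
  a / (a + m%:R) * c m.

Lemma bessel_coef0 (R : realType) (b : R) : bessel_coef b 0 = 1.
Proof. by rewrite /bessel_coef /poch big_ord0 fact0 mulr1 expr0 divff. Qed.

Lemma defect_coef0 (R : realType) (b : R) : defect_coef b 0 = 1.
Proof. by rewrite /defect_coef /poch big_ord0 mulr1 expr0 divff. Qed.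

Lemma avg_coef0 (R : realType) (a : R) (c : nat -> R) :
  0 < a -> avg_coef a c 0 = c 0%N.
Proof. by move=> a0; rewrite /avg_coef addr0 divff ?mul1r // lt0r_neq0. Qed.

Lemma bessel_coef_bounded (R : realType) (b : R) :
  1 <= b -> fact_bounded (bessel_coef b).
Proof.
move=> b1 m; rewrite /bessel_coef normrM normrX normrN1 expr1n mul1r normfV.
have p1 := poch_ge1 m b1.
have f0 : 0 < (m`!%:R : R) by rewrite ltr0n fact_gt0.
rewrite ger0_norm; last by rewrite mulr_ge0 ?ltW // (lt_le_trans ltr01).
rewrite lef_pV2 ?posrE ?mulr_gt0 //; last exact: lt_le_trans ltr01 p1.
by rewrite ler_peMr // ltW.
Qed.

Lemma defect_coef_bounded (R : realType) (b : R) :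
  0 <= b -> fact_bounded (defect_coef b).
Proof.
move=> b0 m; rewrite /defect_coef normrM normrX normrN1 expr1n mul1r normfV.
have p1 : 1 <= poch (b + 1) m by rewrite poch_ge1 // lerDr.
have f0 : 0 < (m`!%:R : R) by rewrite ltr0n fact_gt0.
have f1 : (m`!%:R : R) <= m.+1`!%:R by rewrite ler_nat factS leq_pmull.
have f2 := lt_le_trans f0 f1.
rewrite ger0_norm; last by rewrite mulr_ge0 ?ltW // (lt_le_trans ltr01).
rewrite lef_pV2 ?posrE ?mulr_gt0 //; last exact: lt_le_trans ltr01 p1.
by apply: le_trans f1 _; rewrite ler_peMr // ltW.
Qed.

Lemma avg_coef_bounded (R : realType) (a : R) (c : nat -> R) :
  0 < a -> fact_bounded c -> fact_bounded (avg_coef a c).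
Proof.
move=> a0 hc m; apply: le_trans (hc m).
have am : 0 < a + m%:R by rewrite ltr_wpDr.
rewrite normrM ler_piMl // ger0_norm; last by rewrite divr_ge0 // ltW.
by rewrite ler_pdivrMr // mul1r lerDl.
Qed.

Lemma pssum_avg (R : realType) (a y : R) (c : nat -> R) : 0 < a -> fact_bounded c ->
  y * pssum (pseries_diffs (avg_coef a c)) y + a * pssum (avg_coef a c) y
  = a * pssum c y.
Proof.
move=> a0 hc; apply: pssum_euler => // [|m]; first exact: avg_coef_bounded.
have am : a + m%:R != 0 by rewrite lt0r_neq0 // ltr_wpDr.
by rewrite /avg_coef; field.
Qed.

(** * Energy estimates for the Bessel equation *)

(** The equation y J'' + b J' + J = 0, read as a first-order equation for J'. *)
Lemma bessel_ode (R : realType) (b y : R) : 1 <= b ->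
  let J := bessel_coef b in
  y * pssum (pseries_diffs (pseries_diffs J)) y + b * pssum (pseries_diffs J) y
  = - pssum J y.
Proof.
move=> b1 J; have hJ := bessel_coef_bounded b1.
rewrite -[RHS]mulN1r; apply: pssum_euler => // [|m].
  exact: fact_bounded_diffs.
have b0 := lt_le_trans ltr01 b1.
have f0 : (m`!%:R : R) != 0 by rewrite pnatr_eq0 -lt0n fact_gt0.
have p0 : poch b m != 0 by rewrite lt0r_neq0 ?poch_gt0.
have q0 : b + m%:R != 0 by rewrite lt0r_neq0 // ltr_wpDr.
have s0 : 1 + m%:R != 0 :> R by rewrite lt0r_neq0 // ltr_wpDr.
rewrite /pseries_diffs /J /bessel_coef exprS pochS factS natrM -!natr1.
by field; rewrite f0 p0 q0 addrC.
Qed.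

Lemma defect_bessel (R : realType) (b y : R) : 1 <= b ->
  y * pssum (defect_coef b) y = b * (1 - pssum (bessel_coef b) y).
Proof.
move=> b1; have b0 := lt_le_trans ltr01 b1.
have hJ := bessel_coef_bounded b1.
have hS := defect_coef_bounded (ltW b0).
have E m : bessel_coef b m.+1 = - b^-1 * defect_coef b m + 0 * defect_coef b m.
  rewrite /bessel_coef /defect_coef pochSl exprS.
  have p0 : poch (b + 1) m != 0 by rewrite lt0r_neq0 ?poch_gt0 // addr_gt0.
  have f0 : (m.+1`!%:R : R) != 0 by rewrite pnatr_eq0 -lt0n fact_gt0.
  by field; rewrite f0 p0 lt0r_neq0.
have Ef := funext E.
have cS : cvgn (pseries (fun m => bessel_coef b m.+1) y).
  exact/pseries_bounded_cvg/fact_bounded_shift.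
rewrite {2}/pssum (cvg_lim _ (pseries_shift_cvg cS)) // Ef.
rewrite pssum_lin; [|exact: pseries_bounded_cvg..].
rewrite bessel_coef0 mul0r addr0.
by field; rewrite lt0r_neq0.
Qed.

(** The energy E = J^2 + y J'^2 has derivative (1 - 2 b) J'^2 <= 0 along the
    equation, and E(0) = 1. *)
Lemma bessel_le1 (R : realType) (b y : R) : 1 <= b -> 0 <= y ->
  pssum (bessel_coef b) y ^+ 2 <= 1.
Proof.
move=> b1 y0; have hJ := bessel_coef_bounded b1.
have hJ' := fact_bounded_diffs hJ.
set J : R -> R := pssum (bessel_coef b).
set J' : R -> R := pssum (pseries_diffs (bessel_coef b)).
have J0 : J 0 = 1 by rewrite /J pssum0 bessel_coef0.
pose E : R -> R := - (J * J + id * (J' * J')).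
have dE (x : R) : is_derive x 1 E ((2 * b - 1) * (J' x * J' x)).
  have dJ := is_derive_pssum x hJ; have dJ' := is_derive_pssum x hJ'.
  have dS := is_deriveM (is_derive_id x 1) (is_deriveM dJ' dJ').
  apply: (is_derive_eq (is_deriveN (is_deriveD (is_deriveM dJ dJ) dS))).
  rewrite /GRing.scale /=.
  have := bessel_ode x b1; rewrite /= -/J -/J'; set J'' := pssum _ x => h.
  rewrite -[(J' * J') x]/(J' x * J' x).
  have -> : x * (J' x * J'' + J' x * J'') = 2 * J' x * (x * J'') by ring.
  by rewrite (_ : x * J'' = - J x - b * J' x); [ring|rewrite -h; ring].
have /= := @is_derive_ge0_le _ E (fun x => (2 * b - 1) * (J' x * J' x)) 0 y y0.
have -> : E 0 = - (J 0 * J 0 + 0 * (J' 0 * J' 0)) by [].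
have -> : E y = - (J y * J y + y * (J' y * J' y)) by [].
rewrite J0 mul0r addr0 mulr1 lerN2 => h; apply: le_trans (h _ _) => //.
- by rewrite expr2 lerDl mulr_ge0 // -expr2 sqr_ge0.
- by move=> x _; rewrite mulr_ge0 // -?expr2 ?sqr_ge0 //; lra.
Qed.

(** The energy 4 y J^2 + (2 y J' + J)^2 + (2 b - 3) J^2 has derivative
    - 4 y (2 b - 3) J'^2 <= 0 along the equation, and its value at 0 is 2 b - 2.
    In the variable u = 2 sqrt y this says that u J stays bounded. *)
Lemma bessel_decay (R : realType) (b y : R) : 3 / 2 <= b -> 0 <= y ->
  4 * y * pssum (bessel_coef b) y ^+ 2 <= 2 * b - 2.
Proof.
move=> b32 y0; have b1 : 1 <= b by lra.
have hJ := bessel_coef_bounded b1.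
have hJ' := fact_bounded_diffs hJ.
set J : R -> R := pssum (bessel_coef b).
set J' : R -> R := pssum (pseries_diffs (bessel_coef b)).
have J0 : J 0 = 1 by rewrite /J pssum0 bessel_coef0.
pose G : R -> R := 2 \*: (id * J') + J.
pose E : R -> R := - (4 \*: (id * (J * J)) + G * G + (2 * b - 3) \*: (J * J)).
pose D (x : R) : R := 4 * x * (2 * b - 3) * J' x ^+ 2.
have dE (x : R) : is_derive x 1 E (D x).
  have dJ := is_derive_pssum x hJ; have dJ' := is_derive_pssum x hJ'.
  have dG : is_derive x 1 G _ :=
    is_deriveD (is_deriveZ 2 (is_deriveM (is_derive_id x 1) dJ')) dJ.
  have dS := is_deriveZ 4 (is_deriveM (is_derive_id x 1) (is_deriveM dJ dJ)).
  have dT := is_deriveZ (2 * b - 3) (is_deriveM dJ dJ).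
  apply: (is_derive_eq
    (is_deriveN (is_deriveD (is_deriveD dS (is_deriveM dG dG)) dT))).
  rewrite /GRing.scale /=.
  have := bessel_ode x b1; rewrite /= -/J -/J'; set J'' := pssum _ x => h.
  rewrite -[(J * J) x]/(J x * J x) -[G x]/(2 * (x * J' x) + J x) -/(J' x).
  (* h eliminates J'', which occurs only through x * J''. *)
  rewrite (_ : x * J'' = - J x - b * J' x); last by rewrite -h; ring.
  by rewrite /D; ring.
have := @is_derive_ge0_le _ E D 0 y y0.
have EE x : E x = - (4 * (x * (J x * J x)) + (2 * (x * J' x) + J x)
    * (2 * (x * J' x) + J x) + (2 * b - 3) * (J x * J x)) by [].
rewrite !EE J0 !mul0r !mulr0 !add0r !mulr1 lerN2 => h.
have {}h := h (fun x _ => dE x).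
have -> : 2 * b - 2 = 1 + (2 * b - 3) by ring.
apply: (le_trans _ (h _)); last first.
  move=> x /andP[x0 _]; rewrite /D mulr_ge0 ?sqr_ge0 // mulr_ge0 //; last by lra.
  by rewrite mulr_ge0.
have -> : 4 * y * J y ^+ 2 = 4 * (y * (J y * J y)) by ring.
rewrite -addrA lerDl addr_ge0 // -expr2 ?sqr_ge0 // mulr_ge0 ?sqr_ge0 //.
lra.
Qed.

Lemma defect_ge0 (R : realType) (b y : R) : 1 <= b -> 0 < y ->
  0 <= pssum (defect_coef b) y.
Proof.
move=> b1 y0; rewrite -(pmulr_rge0 _ y0) defect_bessel // mulr_ge0 //; first lra.
have := bessel_le1 b1 (ltW y0); set z := pssum _ y => h.
by rewrite subr_ge0; nra.
Qed.

(** * The eigenvalues as values of two profiles *)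

Lemma pFq_pssum (R : realType) (as_ bs : seq R) (c : nat -> R) (y : R) :
  (forall m, (\prod_(z <- as_) poch z m) / (\prod_(z <- bs) poch z m)
             * ((-1) ^+ m / m`!%:R) = c m) ->
  pFq as_ bs (- y) = pssum c y.
Proof.
move=> h; rewrite /pFq /pssum /pseries; congr (limn (series _)).
by apply/funext => m /=; rewrite -h (exprNn y) !mulrA [in RHS]mulrAC.
Qed.

(** - lambda2 is |nu|^2 times this profile at y = |nu|^2 delta^2 / 4. *)
Definition shear_profile (R : realType) (mu a b y : R) : R :=
  mu * pssum (avg_coef a (defect_coef b)) y.

(** - lambda1 is |nu|^2 times this profile at y = |nu|^2 delta^2 / 4.  The pair
    (5/2; 3/2) of parameters multiplies the m-th coefficient by 1 + 2 m / 3, and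
    (1 + 2 m / 3) a / (a + m) = (1 - 2 a / 3) a / (a + m) + 2 a / 3
    splits the 3F4 into the shear sum and the sum of which that one is the average. *)
Definition dilation_profile (R : realType) (mu lam a b y : R) : R :=
  3 * mu * ((1 - 2 * a / 3) * pssum (avg_coef a (defect_coef b)) y
            + 2 * a / 3 * pssum (defect_coef b) y)
  + (lam - mu) * pssum (avg_coef a (bessel_coef b)) y ^+ 2.

Definition avg_index (R : realType) (n : nat) (beta : R) : R := (n%:R + 2 - beta) / 2.

Definition bessel_index (R : realType) (n : nat) : R := (n%:R + 2) / 2.

Lemma avg_index_gt0 (R : realType) (n : nat) (beta : R) :
  beta < n%:R + 2 -> 0 < avg_index n beta.
Proof. by move=> hb; rewrite divr_gt0 // subr_gt0. Qed.

Lemma bessel_index_ge32 (R : realType) (n : nat) :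
  (1 <= n)%N -> 3 / 2 <= bessel_index R n.
Proof.
rewrite -(ler1n R) /bessel_index; lra.
Qed.

Lemma lambda2E (R : realType) (n : nat) (mu beta delta : R) (nu : 'cV[R]_n) :
  beta < n%:R + 2 ->
  lambda2 mu beta delta nu = - (nrm2 nu *
    shear_profile mu (avg_index n beta) (bessel_index R n)
      (4^-1 * nrm2 nu * delta ^+ 2)).
Proof.
move=> hb; rewrite /lambda2 /shear_profile.
rewrite -!/(avg_index n beta) -!/(bessel_index R n).
set a := avg_index n beta; set b := bessel_index R n; set y := _ * delta ^+ 2.
have a0 : 0 < a by exact: avg_index_gt0.
have b0 : 0 < b + 1 by rewrite /b /bessel_index; have := ler0n R n; lra.
have -> : (n%:R + 4 - beta) / 2 = a + 1 by rewrite /a /avg_index; field.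
have -> : (n%:R + 4) / 2 = b + 1 by rewrite /b /bessel_index; field.
rewrite (@pFq_pssum _ _ _ (avg_coef a (defect_coef b))); first by ring.
move=> m; rewrite !big_cons !big_nil !mulr1 poch1 poch2 (poch_shift1 _ a0).
have p0 : poch (b + 1) m != 0 by rewrite lt0r_neq0 ?poch_gt0.
have q0 : poch a m != 0 by rewrite lt0r_neq0 ?poch_gt0.
have f0 : (m`!%:R : R) != 0 by rewrite pnatr_eq0 -lt0n fact_gt0.
have f1 : (m.+1`!%:R : R) != 0 by rewrite pnatr_eq0 -lt0n fact_gt0.
have am : a + m%:R != 0 by rewrite lt0r_neq0 // ltr_wpDr.
rewrite /avg_coef /defect_coef.
by field; rewrite ?p0 ?q0 ?f0 ?f1 ?am ?lt0r_neq0.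
Qed.

Lemma lambda1E (R : realType) (n : nat) (mu lam beta delta : R)
    (nu : 'cV[R]_n) : beta < n%:R + 2 ->
  lambda1 mu lam beta delta nu = - (nrm2 nu *
    dilation_profile mu lam (avg_index n beta) (bessel_index R n)
      (4^-1 * nrm2 nu * delta ^+ 2)).
Proof.
move=> hb; rewrite /lambda1 /dilation_profile.
rewrite -!/(avg_index n beta) -!/(bessel_index R n).
set a := avg_index n beta; set b := bessel_index R n; set y := _ * delta ^+ 2.
have a0 : 0 < a by exact: avg_index_gt0.
have b0 : 0 < b by rewrite /b /bessel_index; have := ler0n R n; lra.
have -> : (n%:R + 4 - beta) / 2 = a + 1 by rewrite /a /avg_index; field.
have -> : (n%:R + 4) / 2 = b + 1 by rewrite /b /bessel_index; field.
have -> : 5 / 2 = 3 / 2 + 1 :> R by field.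
have hS := defect_coef_bounded (ltW b0).
rewrite -pssum_lin;
  [|exact/pseries_bounded_cvg/avg_coef_bounded|exact: pseries_bounded_cvg].
have am m : a + m%:R != 0 by rewrite lt0r_neq0 // ltr_wpDr.
have q0 m : poch a m != 0 by rewrite lt0r_neq0 ?poch_gt0.
have f0 m : (m`!%:R : R) != 0 by rewrite pnatr_eq0 -lt0n fact_gt0.
rewrite (@pFq_pssum _ [:: 1; _; a] _ (fun m => (1 - 2 * a / 3)
    * avg_coef a (defect_coef b) m + 2 * a / 3 * defect_coef b m)); last first.
  have h32 : 0 < 3 / 2 :> R by lra.
  move=> m; rewrite !big_cons !big_nil !mulr1 poch1 poch2 (poch_shift1 _ a0).
  have p0 : poch (b + 1) m != 0 by rewrite lt0r_neq0 ?poch_gt0 // ltr_wpDr.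
  have r0 : poch (3 / 2 : R) m != 0 by rewrite lt0r_neq0 ?poch_gt0.
  rewrite (poch_shift1 _ h32) /avg_coef /defect_coef.
  by field; rewrite ?p0 ?q0 ?r0 ?f0 ?am ?lt0r_neq0.
rewrite (@pFq_pssum _ [:: a] _ (avg_coef a (bessel_coef b))); first by ring.
move=> m; rewrite !big_cons !big_nil !mulr1 (poch_shift1 _ a0).
have p0 : poch b m != 0 by rewrite lt0r_neq0 ?poch_gt0.
rewrite /avg_coef /bessel_coef.
by field; rewrite ?p0 ?q0 ?f0 ?am ?lt0r_neq0.
Qed.

(** * Growth of the profiles *)

(** This is the integral formula y^a M(y) = a int_0^y x^(a-1) F(x) dx for the
    average M of F, in differentiated form. *)
Lemma is_derive_powR_avg (R : realType) (a y : R) (c : nat -> R) :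
  0 < a -> fact_bounded c -> 0 < y ->
  is_derive y 1 (fun x => x `^ a * pssum (avg_coef a c) x)
    (a * y `^ (a - 1) * pssum c y).
Proof.
move=> a0 hc y0; have dM := is_derive_pssum y (avg_coef_bounded a0 hc).
have dP := is_derive1_powR a y0.
apply: (is_derive_eq (is_deriveM dP dM)).
rewrite /GRing.scale /= mulrAC -(pssum_avg y a0 hc) -(mulr_powRB1 (ltW y0) a0).
by ring.
Qed.

Lemma pssum_continuous (R : realType) (c : nat -> R) :
  fact_bounded c -> continuous (pssum c).
Proof.
move=> hc y; apply/differentiable_continuous; rewrite -derivable1_diffP.
by case: (is_derive_pssum y hc).
Qed.

Lemma avg_defect_lower (R : realType) (a b y : R) : 0 < a -> 1 <= b -> 1 <= y ->
  pssum (avg_coef a (defect_coef b)) 1 <= y `^ a * pssum (avg_coef a (defect_coef b)) y.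
Proof.
move=> a0 b1 y1; have b0 := le_trans ler01 b1.
have hS := defect_coef_bounded b0.
have := @is_derive_ge0_le _ (fun x => x `^ a * pssum (avg_coef a (defect_coef b)) x)
  (fun y => a * y `^ (a - 1) * pssum (defect_coef b) y) 1 y y1.
rewrite powR1 mul1r; apply => x /andP[x1 _]; have x0 := lt_le_trans ltr01 x1.
  exact: is_derive_powR_avg.
by rewrite !mulr_ge0 ?powR_ge0 ?defect_ge0 // ltW.
Qed.

(** By [bessel_decay] the derivative a y^(a-1) J of y^a B is O(y^(a-3/2)), which is
    O(y^(a^2/2-1)) for y >= 1 because a - 1/2 <= a^2/2.  The exponent a^2/2 is
    positive, so that integration loses nothing, and for 0 < a < 1 it is below a/2,
    which is what [dilation_profile_lower] needs. *)
Lemma avg_bessel_upper (R : realType) (a b : R) : 0 < a -> 3 / 2 <= b ->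
  exists2 C, 0 <= C & forall y, 1 <= y ->
  `|y `^ a * pssum (avg_coef a (bessel_coef b)) y| <= C * y `^ (a ^+ 2 / 2).
Proof.
move=> a0 b32; have b1 : 1 <= b by lra.
have hJ := bessel_coef_bounded b1.
set B := pssum _; set g := a ^+ 2 / 2.
have g0 : 0 < g by rewrite /g divr_gt0 // exprn_gt0.
pose K := Num.sqrt (2 * b - 2).
(* The first summand absorbs the value at 1, the second the growth beyond 1. *)
pose C := `|B 1| + a * K / g.
have K0 : 0 <= K by exact: sqrtr_ge0.
have CB : a * K <= C * g.
  by rewrite /C mulrDl divfK ?lt0r_neq0 // lerDr mulr_ge0 // ltW.
exists C.
  by rewrite /C addr_ge0 // divr_ge0 ?mulr_ge0 // ltW.
(* The signs e = 1 and e = -1 give the two sides of the absolute value. *)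
have main (e : R) : e = 1 \/ e = -1 -> forall y, 1 <= y ->
    0 <= C * y `^ g + e * (y `^ a * B y).
  move=> he y y1; have e1 : `|e| = 1 by case: he => ->; rewrite ?normrN normr1.
  pose F : R -> R := C \*: (@powR R ^~ g) + e \*: (fun x => x `^ a * B x).
  have := @is_derive_ge0_le _ F (fun x => C * (g * x `^ (g - 1))
    + e * (a * x `^ (a - 1) * pssum (bessel_coef b) x)) 1 y y1.
  rewrite -[F y]/(C * y `^ g + e * (y `^ a * B y)) => h.
  refine (le_trans _ (h _ _)).
  - rewrite -[F 1]/(C * 1 `^ g + e * (1 `^ a * B 1)) !powR1 mulr1 mul1r.
    rewrite -lerBlDr sub0r (le_trans (ler_norm _)) // normrN normrM e1 mul1r.
    by rewrite /C lerDl divr_ge0 ?mulr_ge0 // ltW.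
  - move=> x /andP[x1 _]; have x0 := lt_le_trans ltr01 x1.
    have dB := is_derive_powR_avg a0 hJ x0.
    have dP := is_derive1_powR g x0.
    exact: is_deriveD (is_deriveZ C dP) (is_deriveZ e dB).
  - move=> x /andP[x1 _]; have x0 := lt_le_trans ltr01 x1.
    set j := pssum _ x.
    have jK : `|j| <= K * x `^ (- 2^-1).
      rewrite powRN (powR12_sqrt (ltW x0)) ler_pdivlMr ?sqrtr_gt0 //.
      rewrite -sqrtr_sqr -sqrtrM ?sqr_ge0 // ler_sqrt; last lra.
      have := bessel_decay b32 (ltW x0); rewrite -/j; have := sqr_ge0 j; nra.
    rewrite -lerBlDr sub0r (le_trans (ler_norm _)) // normrN !normrM e1 mul1r.
    rewrite (ger0_norm (ltW a0)) (ger0_norm (powR_ge0 _ _)) mulrA.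
    apply: le_trans (_ : a * x `^ (a - 1) * (K * x `^ (- 2^-1)) <= _).
      by rewrite ler_wpM2l // mulr_ge0 ?powR_ge0 // ltW.
    have -> : a * x `^ (a - 1) * (K * x `^ (- 2^-1))
      = a * K * (x `^ (a - 1) * x `^ (- 2^-1)) by ring.
    rewrite -powRD; last by rewrite (lt0r_neq0 x0) implybT.
    apply: ler_pM => //; rewrite ?mulr_ge0 ?powR_ge0 //; first exact: ltW.
    apply: ler_powR => //; rewrite /g; have := sqr_ge0 (a - 1); nra.
move=> y y1; rewrite ler_norml.
have := main 1 (or_introl erefl) y y1; have := main (-1) (or_intror erefl) y y1.
by rewrite mulN1r mul1r; lra.
Qed.

Lemma shear_profile0 (R : realType) (mu a b : R) : 0 < a ->
  shear_profile mu a b 0 = mu.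
Proof. by move=> a0; rewrite /shear_profile pssum0 avg_coef0 // defect_coef0 mulr1. Qed.

Lemma dilation_profile0 (R : realType) (mu lam a b : R) : 0 < a ->
  dilation_profile mu lam a b 0 = lam + 2 * mu.
Proof.
move=> a0; rewrite /dilation_profile !pssum0 !avg_coef0 // defect_coef0 bessel_coef0.
by ring.
Qed.

Lemma shear_profile_continuous (R : realType) (mu a b : R) : 0 < a -> 0 <= b ->
  continuous (shear_profile mu a b).
Proof.
move=> a0 b0 y; apply: cvgM; first exact: cvg_cst.
exact/pssum_continuous/avg_coef_bounded/defect_coef_bounded.
Qed.

Lemma dilation_profile_continuous (R : realType) (mu lam a b : R) :
  0 < a -> 1 <= b -> continuous (dilation_profile mu lam a b).
Proof.
move=> a0 b1 y; have b0 := le_trans ler01 b1.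
have hS := defect_coef_bounded b0.
have cM := pssum_continuous (avg_coef_bounded a0 hS) (x := y).
have cS := pssum_continuous hS (x := y).
have cB := pssum_continuous (avg_coef_bounded a0 (bessel_coef_bounded b1)) (x := y).
apply: cvgD; apply: cvgM; try exact: cvg_cst.
  by apply: cvgD; apply: cvgM => //; exact: cvg_cst.
by rewrite expr2; under eq_fun do rewrite expr2; apply: cvgM.
Qed.

(** On [0, Y] the minimum of m is positive by compactness and (1 + y)^a >= 1; beyond
    Y the tail estimate applies because (1 + y)^a >= y^a. *)
Lemma powR_lower_of_tail (R : realType) (m : R -> R) (a c Y : R) :
  0 <= a -> continuous m -> (forall y, 0 <= y -> 0 < m y) ->
  0 <= Y -> 0 < c -> (forall y, Y <= y -> c <= y `^ a * m y) ->
  exists2 c', 0 < c' & forall y, 0 <= y -> c' <= (1 + y) `^ a * m y.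
Proof.
move=> a0 cm m0 Y0 c0 tail.
have [z zI hz] := EVT_min Y0 (continuous_subspaceT cm).
have mz : 0 < m z by apply: m0; move: zI; rewrite in_itv /= => /andP[].
exists (Num.min (m z) c); first by rewrite lt_min mz c0.
move=> y y0; rewrite ge_min; have [yY|/ltW Yy] := leP y Y.
  apply/orP; left; apply: le_trans (hz y _) _; first by rewrite in_itv /= y0 yY.
  rewrite ler_peMl ?(ltW (m0 _ y0)) // -[leLHS](powRr0 (1 + y)).
  by rewrite ler_powR // lerDl.
apply/orP; right; apply: le_trans (tail y Yy) _.
rewrite ler_wpM2r ?(ltW (m0 _ y0)) // ge0_ler_powR //.
- by rewrite nnegrE addr_ge0.
- by rewrite lerDr.
Qed.

Lemma shear_profile_lower (R : realType) (mu a b : R) :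
  0 < a -> 1 <= b -> 0 < mu -> (forall y, 0 < y -> 0 < shear_profile mu a b y) ->
  exists2 c, 0 < c & forall y, 0 <= y -> c <= (1 + y) `^ a * shear_profile mu a b y.
Proof.
move=> a0 b1 mu0 pos; have b0 := le_trans ler01 b1.
apply: (powR_lower_of_tail (c := shear_profile mu a b 1) (Y := 1)).
- exact: ltW.
- exact: shear_profile_continuous.
- move=> y; rewrite le_eqVlt => /orP[/eqP <-|]; last exact: pos.
  by rewrite shear_profile0.
- exact: ler01.
- exact: pos.
- move=> y y1; rewrite /shear_profile mulrCA.
  by apply: ler_wpM2l; [exact: ltW|exact: avg_defect_lower].
Qed.

(** The coefficient lam - mu may be negative but exceeds - 3 mu.  For large y,
    y^a B^2 is at most a sixth of the lower bound m0 of y^a M, where M is the shear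
    average; then 3 mu y^a A >= mu m0 leaves at least mu m0 / 2. *)
Lemma dilation_profile_lower (R : realType) (mu lam a b : R) :
  0 < a < 1 -> 3 / 2 <= b -> 0 < mu -> 0 < lam + 2 * mu ->
  (forall y, 0 < y -> 0 < shear_profile mu a b y) ->
  (forall y, 0 < y -> 0 < dilation_profile mu lam a b y) ->
  exists2 c, 0 < c & forall y, 0 <= y ->
    c <= (1 + y) `^ a * dilation_profile mu lam a b y.
Proof.
move=> /andP[a0 a1] b32 mu0 lm0 pos2 pos1; have b1 : 1 <= b by lra.
have b0 := le_trans ler01 b1.
set m0 := pssum (avg_coef a (defect_coef b)) 1.
have m00 : 0 < m0 by have := pos2 1 ltr01; rewrite pmulr_rgt0.
have [C C0 hC] := avg_bessel_upper a0 b32.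
(* The summand 1 keeps the denominator positive when C = 0. *)
pose e := m0 / (6 * (C ^+ 2 + 1)).
have C1 : 0 < C ^+ 2 + 1 by rewrite ltr_wpDl // sqr_ge0.
have e0 : 0 < e by rewrite divr_gt0 // mulr_gt0.
have h0 : 0 < a - a ^+ 2 by nra.
(* Beyond the second entry of this maximum, y^(a^2-a) <= e. *)
pose Y := Num.max 1 (e `^ (- (a - a ^+ 2)^-1)).
have Y1 : 1 <= Y by rewrite le_max lexx.
apply: (powR_lower_of_tail (c := mu * m0 / 2) (Y := Y)).
- exact: ltW.
- exact: dilation_profile_continuous.
- move=> y; rewrite le_eqVlt => /orP[/eqP <-|]; last exact: pos1.
  by rewrite dilation_profile0.
- exact: le_trans ler01 Y1.
- by rewrite divr_gt0 // mulr_gt0.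
move=> y yY; have y1 := le_trans Y1 yY; have y0 := lt_le_trans ltr01 y1.
have p0 : 0 < y `^ a by exact: powR_gt0.
have hM : m0 <= y `^ a * pssum (avg_coef a (defect_coef b)) y.
  exact: avg_defect_lower.
have hS := defect_ge0 b1 y0.
rewrite /dilation_profile.
set M := pssum (avg_coef a (defect_coef b)) y in hM *.
set S := pssum (defect_coef b) y in hS *.
set B := pssum (avg_coef a (bessel_coef b)) y.
have hy : y `^ (a ^+ 2 - a) <= e.
  have hY : e `^ (- (a - a ^+ 2)^-1) <= y.
    by rewrite (le_trans _ yY) // le_max lexx orbT.
  have := ge0_ler_powR (ltW h0) _ _ hY.
  rewrite !nnegrE powR_ge0 (ltW y0) => /(_ isT isT).
  rewrite -powRrM mulNr mulVf ?lt0r_neq0 // powRN (powRr1 (ltW e0)) => h.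
  rewrite -opprB powRN -[leRHS]invrK lef_pV2 ?posrE ?powR_gt0 //.
  by rewrite invr_gt0.
have hB : y `^ a * B ^+ 2 <= C ^+ 2 * e.
  have := hC y y1; rewrite -/B => hCy.
  have sq : (y `^ a * B) ^+ 2 <= (C * y `^ (a ^+ 2 / 2)) ^+ 2.
    by rewrite -(real_normK (num_real _)) lerXn2r // nnegrE ?mulr_ge0 ?powR_ge0.
  have E1 : (y `^ (a ^+ 2 / 2)) ^+ 2 = y `^ (a ^+ 2).
    by rewrite -powR_mulrn ?powR_ge0 // -powRrM divfK.
  have E2 : y `^ (a ^+ 2) = y `^ a * y `^ (a ^+ 2 - a).
    by rewrite -powRD ?lt0r_neq0 ?implybT // addrC subrK.
  move: sq; rewrite !exprMn E1 E2 expr2 -mulrA [leRHS]mulrCA ler_pM2l // => sq.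
  apply: le_trans sq _; rewrite ler_wpM2l // sqr_ge0 //.
have hCe : C ^+ 2 * e <= m0 / 6.
  have -> : m0 / 6 = (C ^+ 2 + 1) * e by rewrite /e; field; rewrite lt0r_neq0.
  by rewrite ler_wpM2r ?(ltW e0) // lerDl.
set b2 := y `^ a * B ^+ 2 in hB.
have b2_0 : 0 <= b2 by rewrite mulr_ge0 ?sqr_ge0 // ltW.
have -> : y `^ a * (3 * mu * ((1 - 2 * a / 3) * M + 2 * a / 3 * S)
    + (lam - mu) * B ^+ 2)
  = mu * ((3 - 2 * a) * (y `^ a * M)) + 2 * a * mu * (y `^ a * S) + (lam - mu) * b2.
  by rewrite /b2; field.
have h1 : mu * m0 <= mu * ((3 - 2 * a) * (y `^ a * M)).
  rewrite ler_wpM2l ?(ltW mu0) //; set q := y `^ a * M in hM *; nra.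
have h2 : 0 <= 2 * a * mu * (y `^ a * S) by rewrite !mulr_ge0 // ltW.
have h3 : - (3 * mu * (m0 / 6)) <= (lam - mu) * b2.
  have b2m : b2 <= m0 / 6 by exact: le_trans hB hCe.
  nra.
lra.
Qed.

(** For delta <= D the argument y = N delta^2 / 4 satisfies
    1 + y <= (1 + D^2) (1 + N), and N >= (1 + N) / 2 for N >= 1. *)
Lemma profile_coercive (R : realType) (m : R -> R) (a c D : R) :
  0 <= a -> 0 < c -> (forall y, 0 <= y -> c <= (1 + y) `^ a * m y) ->
  exists2 k, 0 < k & forall delta N, 0 < delta <= D -> 1 <= N ->
    k * (1 + N) `^ (1 - a) <= N * m (4^-1 * N * delta ^+ 2).
Proof.
move=> a0 c0 hm; pose K := 1 + D ^+ 2.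
have K0 : 0 < K by rewrite ltr_pwDl // sqr_ge0.
exists (c / (2 * K `^ a)); first by rewrite divr_gt0 // mulr_gt0 ?powR_gt0.
move=> delta N /andP[d0 dD] N1; set y := _ * delta ^+ 2.
have N0 : 0 < 1 + N by lra.
have y0 : 0 <= y by rewrite mulr_ge0 ?sqr_ge0 // mulr_ge0 //; lra.
have yK : 1 + y <= K * (1 + N).
  have : delta ^+ 2 <= D ^+ 2.
    by rewrite lerXn2r ?nnegrE // ?(ltW d0) // (le_trans (ltW d0)).
  rewrite /y /K; have := sqr_ge0 delta; set u := delta ^+ 2; set v := D ^+ 2; nra.
have p0 : 0 < (1 + y) `^ a by rewrite powR_gt0 // ltr_pwDl.
have m0 : 0 < m y by have := lt_le_trans c0 (hm y y0); rewrite pmulr_rgt0.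
have h : c <= K `^ a * (1 + N) `^ a * m y.
  apply: le_trans (hm y y0) _; rewrite ler_wpM2r ?(ltW m0) //.
  rewrite -powRM ?(ltW K0) ?(ltW N0) //.
  rewrite ge0_ler_powR // nnegrE ?mulr_ge0 ?(ltW K0) ?(ltW N0) //.
  by rewrite addr_ge0.
rewrite powRB ?lt0r_neq0 ?implybT // powRr1 ?(ltW N0) //.
set P := K `^ a in h *; set Q := (1 + N) `^ a in h *.
have P0 : 0 < P by exact: powR_gt0.
have Q0 : 0 < Q by exact: powR_gt0.
have -> : c / (2 * P) * ((1 + N) / Q) = (1 + N) / 2 * (c / (P * Q)).
  by field; rewrite ?lt0r_neq0.
apply: (@le_trans _ _ (N * (c / (P * Q)))).
  by rewrite ler_wpM2r; [|rewrite divr_ge0 ?(ltW c0) // mulr_ge0 ?ltW|lra].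
rewrite ler_wpM2l //; first lra.
by rewrite ler_pdivrMr ?mulr_gt0 // mulrC.
Qed.

(** * Solution of the wave equation on one Fourier mode *)

(** For a projection P: the matrix with eigenvalue x on its range, y on its kernel. *)
Definition proj_comb (R : realType) (n : nat) (P : 'M[R]_n) (x y : R) : 'M[R]_n :=
  x *: P + y *: (1%:M - P).

Definition is_proj (R : realType) (n : nat) (P : 'M[R]_n) := P^T = P /\ P *m P = P.

Lemma proj_combM (R : realType) (n : nat) (P : 'M[R]_n) (x y x' y' : R) :
  P *m P = P ->
  proj_comb P x y *m proj_comb P x' y' = proj_comb P (x * x') (y * y').
Proof.
move=> PP; rewrite /proj_comb mulmxDl !mulmxDr -!scalemxAl -!scalemxAr !scalerA.
rewrite !mulmxBl !mulmxBr !mul1mx mulmx1 PP !subrr subr0 !scaler0.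
by rewrite addr0 add0r.
Qed.

Lemma proj_comb_tr (R : realType) (n : nat) (P : 'M[R]_n) (x y : R) :
  P^T = P -> (proj_comb P x y)^T = proj_comb P x y.
Proof.
by move=> Pt; rewrite /proj_comb linearD !linearZ /= linearB /= trmx1 Pt.
Qed.

Lemma proj_comb1 (R : realType) (n : nat) (P : 'M[R]_n) : proj_comb P 1 1 = 1%:M.
Proof. by rewrite /proj_comb !scale1r addrC subrK. Qed.

Lemma proj_combZ (R : realType) (n : nat) (P : 'M[R]_n) (t x y : R) :
  t *: proj_comb P x y = proj_comb P (t * x) (t * y).
Proof. by rewrite /proj_comb scalerDr !scalerA. Qed.

Lemma proj_combB (R : realType) (n : nat) (P : 'M[R]_n) (x y x' y' : R) :
  proj_comb P x y - proj_comb P x' y' = proj_comb P (x - x') (y - y').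
Proof. by rewrite /proj_comb !scalerBl opprD addrACA. Qed.

Lemma toCM (R : realType) (m n p : nat) (A : 'M[R]_(m, n)) (B : 'M[R]_(n, p)) :
  toC (A *m B) = toC A *m toC B.
Proof. by rewrite /toC map_mxM. Qed.

Lemma toCZ (R : realType) (m n : nat) (t : R) (A : 'M[R]_(m, n)) :
  toC (t *: A) = (t%:C)%C *: toC A.
Proof. by apply/matrixP => i j; rewrite !mxE rmorphM. Qed.

Lemma toCD (R : realType) (m n : nat) (A B : 'M[R]_(m, n)) :
  toC (A + B) = toC A + toC B.
Proof. by rewrite /toC map_mxD. Qed.

Lemma toCB (R : realType) (m n : nat) (A B : 'M[R]_(m, n)) :
  toC (A - B) = toC A - toC B.
Proof. by rewrite /toC map_mxB. Qed.

Lemma toC1 (R : realType) (n : nat) : toC (1%:M : 'M[R]_n) = 1%:M.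
Proof. by rewrite /toC map_mx1. Qed.

(** Every vector is a sum of eigenvectors P w + (1 - P) w, on which the functional
    calculus is known by [mxfun_eigen]. *)
Lemma mxfun_proj_comb (R : realType) (n : nat) (h : R -> R) (P : 'M[R]_n) (x y : R) :
  is_proj P -> mxfun h (toC (proj_comb P x y)) = toC (proj_comb P (h x) (h y)).
Proof.
move=> [Pt PP].
have normA : toC (proj_comb P x y) \is normalmx.
  have [U Uu [d ->]] := sym_diag (proj_comb_tr x y Pt).
  by apply/orthomx_spectral_subproof; exists (U, toC d).
have P1 z w : proj_comb P z w *m P = z *: P.
  by rewrite /proj_comb mulmxDl -!scalemxAl mulmxBl mul1mx PP subrr scaler0 addr0.
have P2 z w : proj_comb P z w *m (1%:M - P) = w *: (1%:M - P).
  rewrite /proj_comb mulmxDl -!scalemxAl mulmxBr mulmx1 PP subrr scaler0 add0r.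
  by rewrite mulmxBl mul1mx mulmxBr mulmx1 PP subrr subr0.
have eig (Q : 'M[R]_n) z w :
    proj_comb P x y *m Q = z *: Q -> proj_comb P (h x) (h y) *m Q = h z *: Q ->
    mxfun h (toC (proj_comb P x y)) *m (toC Q *m w)
    = toC (proj_comb P (h x) (h y)) *m (toC Q *m (w : 'cV[R[i]]_n)).
  move=> e1 e2; rewrite (@mxfun_eigen _ _ h _ z) //.
    by rewrite mulmxA -toCM e2 toCZ scalemxAl.
  by rewrite mulmxA -toCM e1 toCZ scalemxAl.
have actE (w : 'cV[R[i]]_n) : mxfun h (toC (proj_comb P x y)) *m w
    = toC (proj_comb P (h x) (h y)) *m w.
  have -> : w = toC P *m w + toC (1%:M - P) *m w.
    by rewrite -mulmxDl -toCD addrC subrK toC1 mul1mx.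
  by rewrite !mulmxDr (eig P x) // (eig (1%:M - P) y).
apply/matrixP => i j; have /colP/(_ i)   := actE (delta_mx j 0).
by rewrite -!colE !mxE.
Qed.

Lemma invmx_proj_comb (R : realType) (n : nat) (P : 'M[R]_n) (x y : R) :
  P *m P = P -> x != 0 -> y != 0 ->
  invmx (toC (proj_comb P x y)) = toC (proj_comb P x^-1 y^-1).
Proof.
move=> PP x0 y0.
have E : toC (proj_comb P x y) *m toC (proj_comb P x^-1 y^-1) = 1%:M.
  by rewrite -toCM proj_combM // !divff // proj_comb1 toC1.
have [Fu _] := mulmx1_unit E.
by rewrite -[RHS](mulKmx Fu) E mulmx1.
Qed.

(** For r > 0 the solutions of v'' = - r v in the variable t are the combinations of
    [cos_mult] and [sin_mult]. *)
Definition cos_mult (R : realType) (t r : R) : R := cos (t * Num.sqrt r).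

Definition sin_mult (R : realType) (t r : R) : R := sin (t * Num.sqrt r) / Num.sqrt r.

Lemma wave_sol_proj (R : realType) (n : nat) (A : 'cV[int]_n -> 'M[R]_n)
    (f g : pdistr R n) (t x y : R) (k : 'cV[int]_n) (P : 'M[R]_n) :
  k != 0 -> is_proj P -> 0 < x -> 0 < y -> A k = proj_comb P (- x) (- y) ->
  wave_sol A f g t k
  = toC (proj_comb P (cos_mult t x) (cos_mult t y)) *m f k
    + toC (proj_comb P (sin_mult t x) (sin_mult t y)) *m g k.
Proof.
move=> k0 hP x0 y0 Ak; have [Pt PP] := hP.
rewrite /wave_sol (negbTE k0) Ak.
have -> : - proj_comb P (- x) (- y) = proj_comb P x y.
  by rewrite -scaleN1r proj_combZ !mulN1r !opprK.
rewrite (mxfun_proj_comb _ _ _ hP) -toCZ proj_combZ !(mxfun_proj_comb _ _ _ hP).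
have w0 (r : R) : 0 < r -> Num.sqrt r != 0 by move=> r0; rewrite gt_eqF // sqrtr_gt0.
by rewrite (invmx_proj_comb PP (w0 x x0) (w0 y y0)) -toCM (proj_combM _ _ _ _ PP).
Qed.

Lemma nrm2_ge0 (R : realType) (n : nat) (v : 'cV[R]_n) : 0 <= nrm2 v.
Proof. by apply: sumr_ge0 => i _; exact: sqr_ge0. Qed.

(** By Pythagoras |(x P + y (1 - P)) v|^2 = x^2 |P v|^2 + y^2 |(1 - P) v|^2. *)
Lemma nrm2_proj_comb (R : realType) (n : nat) (P : 'M[R]_n) (x y e : R)
    (v : 'cV[R]_n) :
  is_proj P -> x ^+ 2 <= e -> y ^+ 2 <= e ->
  nrm2 (proj_comb P x y *m v) <= e * nrm2 v.
Proof.
move=> [Pt PP] xe ye.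
have quad z w : nrm2 (proj_comb P z w *m v)
    = z ^+ 2 * (v^T *m P *m v) 0 0 + w ^+ 2 * (v^T *m (1%:M - P) *m v) 0 0.
  have -> : nrm2 (proj_comb P z w *m v)
      = (v^T *m proj_comb P (z ^+ 2) (w ^+ 2) *m v) 0 0.
    have -> : v^T *m proj_comb P (z ^+ 2) (w ^+ 2) *m v
        = (proj_comb P z w *m v)^T *m (proj_comb P z w *m v).
      rewrite trmx_mul proj_comb_tr // !expr2 -proj_combM // !mulmxA.
      by [].
    by rewrite nrm2E mxE eqxx.
  rewrite /proj_comb; set Q := 1%:M - P.
  by rewrite mulmxDr mulmxDl -!scalemxAr -!scalemxAl !mxE.
have q1 : 0 <= (v^T *m P *m v) 0 0.
  by have := nrm2_ge0 (proj_comb P 1 0 *m v); rewrite quad expr1n expr0n mul1r mul0r addr0.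
have q2 : 0 <= (v^T *m (1%:M - P) *m v) 0 0.
  by have := nrm2_ge0 (proj_comb P 0 1 *m v); rewrite quad expr1n expr0n mul1r mul0r add0r.
have -> : nrm2 v = (v^T *m P *m v) 0 0 + (v^T *m (1%:M - P) *m v) 0 0.
  by have := quad 1 1; rewrite proj_comb1 mul1mx expr1n !mul1r.
by rewrite quad mulrDr lerD // ler_wpM2r.
Qed.

Lemma Cnrm2E (R : realType) (n : nat) (v : 'cV[R[i]]_n) :
  Cnrm2 v = nrm2 (map_mx (@complex.Re R) v) + nrm2 (map_mx (@complex.Im R) v).
Proof.
by rewrite /Cnrm2 big_split; congr (_ + _); apply: eq_bigr => i _; rewrite mxE.
Qed.

Lemma toC_mul_Re (R : realType) (n : nat) (A : 'M[R]_n) (v : 'cV[R[i]]_n) :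
  map_mx (@complex.Re R) (toC A *m v) = A *m map_mx (@complex.Re R) v.
Proof.
apply/colP => i; rewrite !mxE.
rewrite (big_morph (@complex.Re R) (id1 := 0) (op1 := +%R)) //; last by case=> ? ? [].
by apply: eq_bigr => j _; rewrite !mxE; case: (v j 0) => a b /=; rewrite mul0r subr0.
Qed.

Lemma toC_mul_Im (R : realType) (n : nat) (A : 'M[R]_n) (v : 'cV[R[i]]_n) :
  map_mx (@complex.Im R) (toC A *m v) = A *m map_mx (@complex.Im R) v.
Proof.
apply/colP => i; rewrite !mxE.
rewrite (big_morph (@complex.Im R) (id1 := 0) (op1 := +%R)) //; last by case=> ? ? [].
by apply: eq_bigr => j _; rewrite !mxE; case: (v j 0) => a b /=; rewrite mul0r addr0.
Qed.

Lemma Cnrm2_ge0 (R : realType) (n : nat) (v : 'cV[R[i]]_n) : 0 <= Cnrm2 v.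
Proof. by rewrite Cnrm2E addr_ge0 // nrm2_ge0. Qed.

Lemma Cnrm2_proj_comb (R : realType) (n : nat) (P : 'M[R]_n) (x y e : R)
    (v : 'cV[R[i]]_n) :
  is_proj P -> x ^+ 2 <= e -> y ^+ 2 <= e ->
  Cnrm2 (toC (proj_comb P x y) *m v) <= e * Cnrm2 v.
Proof.
move=> hP xe ye; rewrite !Cnrm2E toC_mul_Re toC_mul_Im mulrDr.
by rewrite lerD // nrm2_proj_comb.
Qed.

Lemma Cnrm2D (R : realType) (n : nat) (v w : 'cV[R[i]]_n) :
  Cnrm2 (v + w) <= 2 * (Cnrm2 v + Cnrm2 w).
Proof.
rewrite /Cnrm2 -big_split mulr_sumr; apply: ler_sum => i _ /=.
rewrite mxE; case: (v i 0) => a b; case: (w i 0) => c d /=.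
by have := sqr_ge0 (a - c); have := sqr_ge0 (b - d); nra.
Qed.

Lemma Cnrm2N (R : realType) (n : nat) (v : 'cV[R[i]]_n) : Cnrm2 (- v) = Cnrm2 v.
Proof.
rewrite /Cnrm2; apply: eq_bigr => i _; rewrite mxE.
by case: (v i 0) => a b /=; rewrite !sqrrN.
Qed.

Definition ray_proj (R : realType) (n : nat) (k : 'cV[int]_n) : 'M[R]_n :=
  (nrm2 (toR R k))^-1 *: (toR R k *m (toR R k)^T).

Lemma nrm2_toR_ge1 (R : realType) (n : nat) (k : 'cV[int]_n) :
  k != 0 -> 1 <= nrm2 (toR R k).
Proof.
move=> k0; have [i ki] : exists i, k i 0 != 0.
  apply/existsP; apply: contraR k0 => /existsPn h; apply/eqP/colP => i.
  by have := h i; rewrite negbK mxE => /eqP.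
rewrite /nrm2 (bigD1 i) //= ler_wpDr ?sumr_ge0 // => [j _|]; first exact: sqr_ge0.
by rewrite mxE -rmorphXn /= -[1]/(1%:~R) ler_int -gtz0_ge1 lt_def sqrf_eq0 ki sqr_ge0.
Qed.

Lemma ray_proj_is_proj (R : realType) (n : nat) (k : 'cV[int]_n) :
  k != 0 -> is_proj (@ray_proj R n k).
Proof.
move=> /(@nrm2_toR_ge1 R) N1; rewrite /ray_proj.
set v := toR R k in N1 *; set N := nrm2 v in N1 *.
have N0 : N != 0 by rewrite lt0r_neq0 // (lt_le_trans ltr01).
split; first by rewrite linearZ /= trmx_mul trmxK.
rewrite -scalemxAl -scalemxAr -mulmxA (mulmxA v^T) nrm2E -/N mul_scalar_mx.
by rewrite -!scalemxAr scalerA mulVf // scale1r.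
Qed.

Lemma navier_mult_proj (R : realType) (n : nat) (mu lam : R) (k : 'cV[int]_n) :
  k != 0 -> let N := nrm2 (toR R k) in
  navier_mult mu lam k
  = proj_comb (ray_proj R k) (- ((lam + 2 * mu) * N)) (- (mu * N)).
Proof.
move=> /(@nrm2_toR_ge1 R) N1 N.
have N0 : N != 0 by rewrite lt0r_neq0 // (lt_le_trans ltr01).
rewrite /navier_mult /proj_comb /ray_proj -/N; set Q := _ *m _.
apply/matrixP => i j; rewrite !mxE; set q := Q i j; set d := (_ *+ _).
by field.
Qed.

(** * Dominated convergence in the Sobolev norm *)

Lemma esum_mulr_lty (R : realType) (I : choiceType) (C : R) (a : I -> \bar R) :
  0 <= C -> (forall i, 0 <= a i)%E ->
  (\esum_(i in [set: I]) a i < +oo)%E ->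
  (\esum_(i in [set: I]) (C%:E * a i) < +oo)%E.
Proof.
move=> C0 a0 ha; have S0 : (0 <= \esum_(i in [set: I]) a i)%E by apply: esum_ge0.
apply: (@le_lt_trans _ _ (C%:E * \esum_(i in [set: I]) a i)%E); last first.
  by rewrite -ge0_fin_numE ?mule_ge0 ?lee_fin // fin_numM // ge0_fin_numE.
apply: ge_ereal_sup => _ [X [finX XI]] <-.
rewrite -ge0_mule_fsumr //; apply: lee_wpmul2l; first by rewrite lee_fin.
by apply: ereal_sup_ubound; exists X.
Qed.

(** A finite set carries all of the sum of D but e / 2.  Off this set the sums of a
    are below e / 2 by domination, and on it they tend to 0 term by term. *)
Lemma esum_dominated_small (R : realType) (T : Type) (F : set_system T)
    (I : choiceType) (a : T -> I -> R) (D : I -> R) :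
  Filter F ->
  (\forall t \near F, forall i, 0 <= a t i <= D i) ->
  (forall i, 0 <= D i) ->
  (forall i, a t i @[t --> F] --> 0) ->
  (\esum_(i in [set: I]) (D i)%:E < +oo)%E ->
  forall e : R, 0 < e ->
  \forall t \near F, (\esum_(i in [set: I]) (a t i)%:E <= e%:E)%E.
Proof.
move=> FF aD D0 acvg SD e e0.
have D0E i : [set: I] i -> (0 <= (D i)%:E)%E by rewrite lee_fin.
have Sfin : (\esum_(i in [set: I]) (D i)%:E)%E \is a fin_num.
  by rewrite ge0_fin_numE // esum_ge0.
have e2 : 0 < e / 2 by rewrite divr_gt0.
have [_ [X [finX _] <-] hX] := ub_ereal_sup_adherent e2 Sfin.
have tail : (\esum_(i in ~` X) (D i)%:E <= (e / 2)%:E)%E.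
  move: hX; rewrite -/(esum _ _) (esumID X _ _ D0E) !setTI.
  rewrite (@esum_fset _ _ X) // => [|i _]; last by rewrite lee_fin.
  rewrite fsumEFin //; set S := (\sum_(i \in X) D i)%R.
  case: (esum _ _) => [r||] //=.
  - by rewrite -!EFinD lte_fin lee_fin; lra.
  - by rewrite leNye.
have fincvg : (\sum_(i <- fset_set X) a t i)%R @[t --> F] --> (0 : R).
  have E : \sum_(i <- fset_set X) (fun=> 0 : R) i = 0 :> R by exact: big1.
  rewrite -[X in _ --> X]E.
  exact: (cvg_big add_continuous FF (fun i _ => acvg i)).
have small : \forall t \near F, `|\sum_(i <- fset_set X) a t i| <= e / 2.
  by move/cvgr0Pnorm_le : fincvg; apply.
apply: filterS2 aD small => t aDt small_t.
have at0 i : (0 <= (a t i)%:E)%E by rewrite lee_fin; case/andP: (aDt i).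
rewrite (esumID X) // !setTI esum_fset // fsumEFin // fsbig_finite //.
have -> : e%:E = ((e / 2)%:E + (e / 2)%:E)%E by rewrite -EFinD -splitr.
apply: leeD.
  by rewrite lee_fin (le_trans (ler_norm _)).
apply: le_trans tail; apply: le_esum => i _; rewrite lee_fin.
by case/andP: (aDt i).
Qed.

Definition weight (R : realType) (n : nat) (k : 'cV[int]_n) : R := 1 + nrm2 (toR R k).

Lemma weight_ge1 (R : realType) (n : nat) (k : 'cV[int]_n) : 1 <= weight R k.
Proof. by rewrite lerDl nrm2_ge0. Qed.

Definition Hterm (R : realType) (n : nat) (q : R) (u : pdistr R n)
    (k : 'cV[int]_n) : R :=
  weight R k `^ q * Cnrm2 (u k).

Lemma Hterm_ge0 (R : realType) (n : nat) (q : R) (u : pdistr R n) k :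
  0 <= Hterm q u k.
Proof. by rewrite mulr_ge0 ?powR_ge0 ?Cnrm2_ge0. Qed.

Lemma inHP (R : realType) (n : nat) (q : R) (u : pdistr R n) :
  inH q u <-> (\esum_(k in [set: 'cV[int]_n]) (Hterm q u k)%:E < +oo)%E.
Proof.
have S0 : (0 <= \esum_(k in [set: 'cV[int]_n]) (Hterm q u k)%:E)%E.
  by apply: esum_ge0 => k _; rewrite lee_fin Hterm_ge0.
by rewrite -ge0_fin_numE // -(sqrte_fin_num S0) ge0_fin_numE ?sqrte_ge0.
Qed.

Lemma Hnorm_cvg0 (R : realType) (T : Type) (F : set_system T) (n : nat) (q : R)
    (u : T -> pdistr R n) (D : 'cV[int]_n -> R) :
  Filter F ->
  (\forall t \near F, forall k, Hterm q (u t) k <= D k) ->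
  (forall k, 0 <= D k) ->
  (forall k, Cnrm2 (u t k) @[t --> F] --> 0) ->
  (\esum_(k in [set: 'cV[int]_n]) (D k)%:E < +oo)%E ->
  Hnorm q (u t) @[t --> F] --> 0%E.
Proof.
move=> FF uD D0 ucvg SD.
have small e : 0 < e -> \forall t \near F, (Hnorm q (u t) <= e%:E)%E.
  move=> e0; have e2 : 0 < e ^+ 2 by rewrite exprn_gt0.
  have : \forall t \near F, (\esum_(k in [set: 'cV[int]_n]) (Hterm q (u t) k)%:E
      <= (e ^+ 2)%:E)%E.
    apply: (esum_dominated_small (D := D)) => //.
      by apply: filterS uD => t h k; rewrite Hterm_ge0 h.
    move=> k; rewrite -(mulr0 (weight R k `^ q)).
    by apply: cvgM; [exact: cvg_cst|exact: ucvg].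
  apply: filterS => t h.
  have -> : e%:E = sqrte (e ^+ 2)%:E by rewrite /= sqrtr_sqr ger0_norm // ltW.
  by rewrite lee_sqrt // lee_fin ltW.
have fin e t : (Hnorm q (u t) <= e%:E)%E -> Hnorm q (u t) \is a fin_num.
  by move=> h; rewrite ge0_fin_numE ?sqrte_ge0 // (le_lt_trans h) // ltry.
apply/fine_cvgP; split.
  by apply: filterS (small 1 ltr01) => t; exact: fin.
apply/cvgr0Pnorm_le => e e0; apply: filterS (small e e0) => t h.
have hf := fin _ _ h.
rewrite /= ger0_norm ?fine_ge0 ?sqrte_ge0 //.
by rewrite -lee_fin fineK.
Qed.

(** * Bounds for the scalar wave factors *)

Lemma sqr_cos_le1 (R : realType) (x : R) : cos x ^+ 2 <= 1.
Proof. by rewrite -(cos2Dsin2 x) lerDl sqr_ge0. Qed.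

Lemma sqr_sin_le1 (R : realType) (x : R) : sin x ^+ 2 <= 1.
Proof. by rewrite -(cos2Dsin2 x) lerDr sqr_ge0. Qed.

Lemma sin_le_id (R : realType) (x : R) : 0 <= x -> `|sin x| <= x.
Proof.
move=> x0; rewrite ler_norml; apply/andP; split.
  have := @is_derive_ge0_le _ (id + @sin R) (fun x => 1 + cos x) 0 x x0.
  rewrite !fctE sin0 addr0 => h; rewrite -subr_ge0 opprK addrC; apply: h => z _.
  by rewrite -lerBlDl sub0r cos_geN1.
have := @is_derive_ge0_le _ (id - @sin R) (fun x => 1 - cos x) 0 x x0.
rewrite !fctE sin0 subr0 => h; rewrite -subr_ge0; apply: h => z _.
by rewrite subr_ge0 cos_le1.
Qed.

Lemma sin_mult_le_time (R : realType) (t r : R) : 0 <= t -> 0 < r ->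
  sin_mult t r ^+ 2 <= t ^+ 2.
Proof.
move=> t0 r0; have w0 : 0 < Num.sqrt r by rewrite sqrtr_gt0.
rewrite -real_normK ?num_real // lerXn2r ?nnegrE //.
rewrite normrM normfV (ger0_norm (ltW w0)) ler_pdivrMr //.
by apply: sin_le_id; rewrite mulr_ge0 // ltW.
Qed.

Lemma sin_mult_le_inv (R : realType) (t r : R) : 0 < r -> sin_mult t r ^+ 2 <= r^-1.
Proof.
move=> r0; rewrite /sin_mult expr_div_n sqr_sqrtr ?(ltW r0) //.
by rewrite ler_pdivrMr // mulVf ?lt0r_neq0 // sqr_sin_le1.
Qed.

Lemma cos_mult_continuous (R : realType) (t r : R) :
  {for r, continuous (cos_mult t)}.
Proof.
apply: (@continuous_comp _ _ _ (fun r => t * Num.sqrt r) (@cos R)); last first.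
  exact: continuous_cos.
by apply: cvgM; [exact: cvg_cst|exact: sqrt_continuous].
Qed.

Lemma sin_mult_continuous (R : realType) (t r : R) : 0 < r ->
  {for r, continuous (sin_mult t)}.
Proof.
move=> r0; apply: cvgM.
  apply: (@continuous_comp _ _ _ (fun r => t * Num.sqrt r) (@sin R)); last first.
    exact: continuous_sin.
  by apply: cvgM; [exact: cvg_cst|exact: sqrt_continuous].
by apply: cvgV; [rewrite lt0r_neq0 ?sqrtr_gt0|exact: sqrt_continuous].
Qed.

(** * Domination of the solutions *)

(** At every nonzero mode the sine factors gain p derivatives: they are
    O((1 + |k|^2)^(-p/2)), with the constant C for their squares. *)
Definition wave_decay (R : realType) (n : nat) (A : 'cV[int]_n -> 'M[R]_n)
    (t C p : R) :=
  forall k, k != 0 -> exists x y : R,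
    [/\ 0 < x, 0 < y, A k = proj_comb (ray_proj R k) (- x) (- y),
        sin_mult t x ^+ 2 <= C * weight R k `^ (- p)
      & sin_mult t y ^+ 2 <= C * weight R k `^ (- p)].

(** A summable majorant of the squared modes of a solution that involves only the
    data and the constant C: one majorant serves all delta for which C is the same. *)
Definition data_bound (R : realType) (n : nat) (s1 s2 C : R) (f g : pdistr R n)
    (k : 'cV[int]_n) : R := 2 * (Hterm s1 f k + C * Hterm s2 g k).

Lemma data_bound_ge0 (R : realType) (n : nat) (s1 s2 C : R) (f g : pdistr R n) k :
  0 <= C -> 0 <= data_bound s1 s2 C f g k.
Proof. by move=> C0; rewrite mulr_ge0 // addr_ge0 ?Hterm_ge0 // mulr_ge0 ?Hterm_ge0. Qed.

Lemma data_bound_lty (R : realType) (n : nat) (s1 s2 C : R) (f g : pdistr R n) :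
  0 <= C -> inH s1 f -> inH s2 g ->
  (\esum_(k in [set: 'cV[int]_n]) (data_bound s1 s2 C f g k)%:E < +oo)%E.
Proof.
move=> C0 /inHP hf /inHP hg.
have nn q (u : pdistr R n) (k : 'cV[int]_n) : (0 <= (Hterm q u k)%:E)%E.
  by rewrite lee_fin Hterm_ge0.
have -> : (\esum_(k in [set: 'cV[int]_n]) (data_bound s1 s2 C f g k)%:E)%E
  = (\esum_(k in [set: 'cV[int]_n])
      ((2 : R)%:E * ((Hterm s1 f k)%:E + C%:E * (Hterm s2 g k)%:E)))%E.
  by [].
apply: esum_mulr_lty => // [k|]; first by rewrite adde_ge0 // mule_ge0.
rewrite esumD // => [|k _]; last by rewrite mule_ge0.
by rewrite lte_add_pinfty // esum_mulr_lty.
Qed.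

(** The weight (1 + |k|^2)^s' is at most (1 + |k|^2)^s1 on the part coming from f.
    On the part coming from g the decay (1 + |k|^2)^(-p) of the sine factor brings it
    down to (1 + |k|^2)^s2. *)
Lemma Hterm_wave_sol (R : realType) (n : nat) (A : 'cV[int]_n -> 'M[R]_n)
    (f g : pdistr R n) (t C p s1 s2 : R) (k : 'cV[int]_n) :
  t ^+ 2 <= C -> wave_decay A t C p ->
  Hterm (Num.min s1 (s2 + p)) (wave_sol A f g t) k <= data_bound s1 s2 C f g k.
Proof.
move=> tC hA; rewrite /data_bound /Hterm; set W := weight R k.
have W1 : 1 <= W := weight_ge1 R k.
have W0 : 0 < W := lt_le_trans ltr01 W1.
have C0 : 0 <= C := le_trans (sqr_ge0 t) tC.
suff h : Cnrm2 (wave_sol A f g t k)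
    <= 2 * (1 * Cnrm2 (f k) + C * W `^ (- p) * Cnrm2 (g k)).
  apply: le_trans (ler_wpM2l (powR_ge0 _ _) h) _.
  rewrite mulrCA ler_wpM2l // mul1r mulrDr; apply: lerD.
    by rewrite ler_wpM2r ?Cnrm2_ge0 // ler_powR // ge_min lexx.
  rewrite !mulrA ler_wpM2r ?Cnrm2_ge0 // [leLHS]mulrAC -powRD; last first.
    by rewrite lt0r_neq0 ?implybT.
  rewrite mulrC ler_wpM2l // ler_powR // lerBlDr.
  by rewrite ge_min lexx orbT.
have [k0|k0] := eqVneq k 0.
  have W1E : W = 1.
    rewrite /W /weight k0 /nrm2 big1 ?addr0 // => i _.
    by rewrite !mxE expr0n.
  rewrite W1E powR1 mulr1 /wave_sol k0 eqxx.
  apply: le_trans (Cnrm2D _ _) _; rewrite ler_wpM2l // mul1r lerD2l.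
  (* The zero matrix is a projection, and P = 0 makes t 1 a combination. *)
  have -> : (t%:C)%C *: g 0 = toC (proj_comb 0 t t) *m g 0.
    by rewrite /proj_comb scaler0 add0r subr0 toCZ toC1 -scalemxAl mul1mx.
  by apply: Cnrm2_proj_comb => //; split; rewrite ?trmx0 ?mulmx0.
have [x [y [x0 y0 Ak sx sy]]] := hA k k0.
have hP := ray_proj_is_proj R k0.
rewrite (wave_sol_proj f g t k0 hP x0 y0 Ak).
apply: le_trans (Cnrm2D _ _) _; rewrite ler_wpM2l //.
by apply: lerD; apply: Cnrm2_proj_comb => //; exact: sqr_cos_le1.
Qed.

Lemma inH_wave_sol (R : realType) (n : nat) (A : 'cV[int]_n -> 'M[R]_n)
    (f g : pdistr R n) (t C p s1 s2 : R) :
  t ^+ 2 <= C -> wave_decay A t C p -> inH s1 f -> inH s2 g ->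
  inH (Num.min s1 (s2 + p)) (wave_sol A f g t).
Proof.
move=> tC hA hf hg; apply/inHP; have C0 := le_trans (sqr_ge0 t) tC.
apply: le_lt_trans (data_bound_lty C0 hf hg); apply: le_esum => k _.
by rewrite lee_fin Hterm_wave_sol.
Qed.

Lemma wave_decay_le (R : realType) (n : nat) (A : 'cV[int]_n -> 'M[R]_n)
    (t C C' p q : R) :
  0 <= C -> C <= C' -> q <= p -> wave_decay A t C p -> wave_decay A t C' q.
Proof.
move=> C0 CC qp hA k k0; have [x [y [x0 y0 Ak sx sy]]] := hA k k0.
have le : C * weight R k `^ (- p) <= C' * weight R k `^ (- q).
  by apply: ler_pM => //; rewrite ?powR_ge0 // ler_powR ?weight_ge1 // lerN2.
by exists x, y; split => //; apply: le_trans le.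
Qed.

Lemma sin_mult_coercive (R : realType) (t c V r : R) :
  0 < c -> 0 < V -> c * V <= r -> sin_mult t r ^+ 2 <= Num.max (t ^+ 2) c^-1 * V^-1.
Proof.
move=> c0 V0 cr; have cV : 0 < c * V by rewrite mulr_gt0.
apply: le_trans (sin_mult_le_inv t (lt_le_trans cV cr)) _.
apply: (@le_trans _ _ (c^-1 * V^-1)).
  by rewrite -invfM lef_pV2 ?posrE // (lt_le_trans cV).
by rewrite ler_wpM2r ?invr_ge0 ?(ltW V0) // le_max lexx orbT.
Qed.

(** The Navier eigenvalues are at least min(mu, lam + 2 mu) |k|^2 and
    |k|^2 >= (1 + |k|^2) / 2: a full derivative is gained. *)
Lemma navier_decay (R : realType) (n : nat) (mu lam t : R) :
  0 < mu -> 0 < lam + 2 * mu ->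
  exists2 C, t ^+ 2 <= C & wave_decay (@navier_mult R n mu lam) t C 1.
Proof.
move=> mu0 lm0; pose l := Num.min mu (lam + 2 * mu) / 2.
have l0 : 0 < l by rewrite divr_gt0 // lt_min mu0 lm0.
exists (Num.max (t ^+ 2) l^-1); first by rewrite le_max lexx.
move=> k k0; have N1 := nrm2_toR_ge1 R k0.
have W0 : 0 < weight R k := lt_le_trans ltr01 (weight_ge1 R k).
rewrite powRN powRr1 ?(ltW W0) //.
set N := nrm2 (toR R k) in N1; have N0 : 0 < N by lra.
have bound r : Num.min mu (lam + 2 * mu) <= r -> l * weight R k <= r * N.
  rewrite /l /weight -/N; set q := Num.min _ _ in l0 * => qr.
  have q0 : 0 < q by rewrite lt_min mu0 lm0.
  nra.
exists ((lam + 2 * mu) * N), (mu * N); split; rewrite ?mulr_gt0 //.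
- exact: navier_mult_proj.
- by apply: sin_mult_coercive => //; apply: bound; rewrite ge_min lexx orbT.
- by apply: sin_mult_coercive => //; apply: bound; rewrite ge_min lexx.
Qed.

(** * Decay of the peridynamic multipliers *)

(** Every positive value of y = |nu|^2 delta^2 / 4 is reached with a unit vector nu;
    this turns the sign conditions on the eigenvalues into positivity of the profiles
    on the whole half-line.  A unit vector exists because n >= 1. *)
Lemma test_vector (R : realType) (n : nat) (y : R) : (1 <= n)%N -> 0 < y ->
  exists (delta : R) (nu : 'cV[R]_n),
  [/\ 0 < delta, nu != 0, nrm2 nu = 1 & 4^-1 * nrm2 nu * delta ^+ 2 = y].
Proof.
move=> n_gt0 y0; exists (2 * Num.sqrt y), (delta_mx (Ordinal n_gt0) 0).
have nE : nrm2 (delta_mx (Ordinal n_gt0) 0 : 'cV[R]_n) = 1.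
  rewrite /nrm2 (bigD1 (Ordinal n_gt0)) //= mxE !eqxx expr1n big1 ?addr0 // => i ni.
  by rewrite mxE (negbTE ni) expr0n.
split => //.
- by rewrite mulr_gt0 // sqrtr_gt0.
- apply/eqP => /(congr1 (@nrm2 R n)); rewrite nE /nrm2 big1 => [/eqP|i _].
    by rewrite oner_eq0.
  by rewrite mxE expr0n.
- by rewrite nE exprMn sqr_sqrtr ?(ltW y0) //; field.
Qed.

Lemma shear_profile_gt0 (R : realType) (n : nat) (mu beta y : R) :
  (1 <= n)%N -> beta < n%:R + 2 ->
  (forall (delta : R) (nu : 'cV[R]_n), 0 < delta -> nu != 0 ->
     lambda2 mu beta delta nu < 0) ->
  0 < y -> 0 < shear_profile mu (avg_index n beta) (bessel_index R n) y.
Proof.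
move=> n_gt0 hb neg /(test_vector n_gt0)[delta [nu [d0 nu0 n1 yE]]].
by have := neg delta nu d0 nu0; rewrite lambda2E // yE n1 mul1r oppr_lt0.
Qed.

Lemma dilation_profile_gt0 (R : realType) (n : nat) (mu lam beta y : R) :
  (1 <= n)%N -> beta < n%:R + 2 ->
  (forall (delta : R) (nu : 'cV[R]_n), 0 < delta -> nu != 0 ->
     lambda1 mu lam beta delta nu < 0) ->
  0 < y -> 0 < dilation_profile mu lam (avg_index n beta) (bessel_index R n) y.
Proof.
move=> n_gt0 hb neg /(test_vector n_gt0)[delta [nu [d0 nu0 n1 yE]]].
by have := neg delta nu d0 nu0; rewrite lambda1E // yE n1 mul1r oppr_lt0.
Qed.

Lemma toR_neq0 (R : realType) (n : nat) (k : 'cV[int]_n) : k != 0 -> toR R k != 0.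
Proof.
move=> k0; apply/eqP => v0; have := nrm2_toR_ge1 R k0.
by rewrite v0 /nrm2 big1 ?ler10 // => i _; rewrite mxE expr0n.
Qed.

(** For beta <= n no derivative is gained and |sin (t w) / w| <= t suffices.  For
    beta > n the gain is 1 - a = (beta - n) / 2, by coercivity of the profiles.  The
    constant depends only on an upper bound D of delta. *)
Lemma peri_decay (R : realType) (n : nat) (mu lam beta t D : R) :
  (1 <= n)%N -> beta < n%:R + 2 -> 0 < mu -> 0 < lam + 2 * mu ->
  (forall (delta : R) (nu : 'cV[R]_n), 0 < delta -> nu != 0 ->
     lambda1 mu lam beta delta nu < 0) ->
  (forall (delta : R) (nu : 'cV[R]_n), 0 < delta -> nu != 0 ->
     lambda2 mu beta delta nu < 0) ->
  0 <= t ->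
  exists2 C, t ^+ 2 <= C & forall delta : R, 0 < delta <= D ->
    wave_decay (@peri_mult R n mu lam beta delta) t C
      (Num.max 0 ((beta - n%:R) / 2)).
Proof.
move=> n_gt0 hb mu0 lm0 l1_lt0 l2_lt0 t0; set p := Num.max _ _.
set a := avg_index n beta; set b := bessel_index R n.
have a_gt0 : 0 < a by exact: avg_index_gt0.
have neg (delta : R) (k : 'cV[int]_n) : 0 < delta -> k != 0 ->
    lambda1 mu lam beta delta (toR R k) < 0
    /\ lambda2 mu beta delta (toR R k) < 0.
  move=> d0 /(@toR_neq0 R) v0.
  by split; [exact: l1_lt0 d0 v0|exact: l2_lt0 d0 v0].
have comb (delta : R) (k : 'cV[int]_n) : peri_mult mu lam beta delta k
    = proj_comb (ray_proj R k) (- - lambda1 mu lam beta delta (toR R k))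
                               (- - lambda2 mu beta delta (toR R k)).
  by rewrite !opprK.
have [bn|bn] := leP ((beta - n%:R) / 2) 0.
  have -> : p = 0 by rewrite /p; apply/max_idPl.
  exists (t ^+ 2) => // delta /andP[d0 _] k k0.
  have [l1 l2] := neg delta k d0 k0.
  exists (- lambda1 mu lam beta delta (toR R k)), (- lambda2 mu beta delta (toR R k)).
  by rewrite oppr0 powRr0 mulr1 !oppr_gt0; split => //;
    apply: sin_mult_le_time => //; rewrite oppr_gt0.
have pE : p = 1 - a.
  by rewrite /p; have /ltW/max_idPr -> := bn; rewrite /a /avg_index; field.
have b32 : 3 / 2 <= b by exact: bessel_index_ge32.
have b1 : 1 <= b by lra.
have a1 : a < 1 by rewrite /a /avg_index; lra.
have [c1 c1_0 hc1] : exists2 c, 0 < c & forall y, 0 <= y ->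
    c <= (1 + y) `^ a * dilation_profile mu lam a b y.
  apply: dilation_profile_lower => //; first by rewrite a_gt0 a1.
    by move=> y; exact: shear_profile_gt0.
  by move=> y; exact: dilation_profile_gt0.
have [c2 c2_0 hc2] : exists2 c, 0 < c & forall y, 0 <= y ->
    c <= (1 + y) `^ a * shear_profile mu a b y.
  by apply: shear_profile_lower => // y; exact: shear_profile_gt0.
have [k1 k1_0 hk1] := profile_coercive D (ltW a_gt0) c1_0 hc1.
have [k2 k2_0 hk2] := profile_coercive D (ltW a_gt0) c2_0 hc2.
pose c := Num.min k1 k2; have c0 : 0 < c by rewrite lt_min k1_0.
exists (Num.max (t ^+ 2) c^-1); first by rewrite le_max lexx.
move=> delta dD k k0; have [d0 _] := andP dD.
have [l1 l2] := neg delta k d0 k0; have N1 := nrm2_toR_ge1 R k0.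
exists (- lambda1 mu lam beta delta (toR R k)), (- lambda2 mu beta delta (toR R k)).
have W0 : 0 < weight R k `^ p.
  by rewrite powR_gt0 // (lt_le_trans ltr01) // weight_ge1.
rewrite powRN !oppr_gt0; split => //; apply: sin_mult_coercive => //.
  rewrite lambda1E // opprK pE; apply: le_trans (hk1 _ _ dD N1).
  by rewrite ler_wpM2r ?powR_ge0 // ge_min lexx.
rewrite lambda2E // opprK pE; apply: le_trans (hk2 _ _ dD N1).
by rewrite ler_wpM2r ?powR_ge0 // ge_min lexx orbT.
Qed.

(** * The limit of vanishing horizon *)

(** For fixed k the argument of the profile tends to 0 with delta. *)
Lemma lambda1_cvg (R : realType) (n : nat) (mu lam beta : R) (k : 'cV[int]_n) :
  (1 <= n)%N -> beta < n%:R + 2 ->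
  - lambda1 mu lam beta delta (toR R k) @[delta --> 0^'+]
    --> (lam + 2 * mu) * nrm2 (toR R k).
Proof.
move=> n_gt0 hb; have a_gt0 := avg_index_gt0 hb.
have b32 := bessel_index_ge32 R n_gt0.
have b1 : 1 <= bessel_index R n by lra.
under eq_fun do rewrite lambda1E // opprK.
rewrite mulrC; apply: cvgM; first exact: cvg_cst.
rewrite -(@dilation_profile0 _ mu lam _ (bessel_index R n) a_gt0).
apply: cvg_at_right_filter.
pose h (d : R) := 4^-1 * nrm2 (toR R k) * d ^+ 2.
have h0 : h 0 = 0 by rewrite /h expr0n mulr0.
rewrite -{2}h0; apply: (@continuous_comp _ _ _ h).
  by apply: cvgM; [exact: cvg_cst|exact: exprn_continuous].
by apply: dilation_profile_continuous.
Qed.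

Lemma lambda2_cvg (R : realType) (n : nat) (mu beta : R) (k : 'cV[int]_n) :
  (1 <= n)%N -> beta < n%:R + 2 ->
  - lambda2 mu beta delta (toR R k) @[delta --> 0^'+] --> mu * nrm2 (toR R k).
Proof.
move=> n_gt0 hb; have a_gt0 := avg_index_gt0 hb.
have b32 := bessel_index_ge32 R n_gt0.
have b0 : 0 <= bessel_index R n by lra.
under eq_fun do rewrite lambda2E // opprK.
rewrite mulrC; apply: cvgM; first exact: cvg_cst.
rewrite -{2}(@shear_profile0 _ mu _ (bessel_index R n) a_gt0).
apply: cvg_at_right_filter.
pose h (d : R) := 4^-1 * nrm2 (toR R k) * d ^+ 2.
have h0 : h 0 = 0 by rewrite /h expr0n mulr0.
rewrite -{2}h0; apply: (@continuous_comp _ _ _ h).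
  by apply: cvgM; [exact: cvg_cst|exact: exprn_continuous].
by apply: shear_profile_continuous.
Qed.

(** Both solutions act on a mode through the same projection, so that the scalar
    factors may be subtracted. *)
Lemma wave_sol_diff (R : realType) (n : nat) (A A' : 'cV[int]_n -> 'M[R]_n)
    (f g : pdistr R n) (t x y x' y' : R) (k : 'cV[int]_n) (P : 'M[R]_n) :
  k != 0 -> is_proj P -> 0 < x -> 0 < y -> 0 < x' -> 0 < y' ->
  A k = proj_comb P (- x) (- y) -> A' k = proj_comb P (- x') (- y') ->
  Cnrm2 (wave_sol A f g t k - wave_sol A' f g t k)
  <= 2 * (((cos_mult t x - cos_mult t x') ^+ 2
           + (cos_mult t y - cos_mult t y') ^+ 2) * Cnrm2 (f k)
          + ((sin_mult t x - sin_mult t x') ^+ 2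
             + (sin_mult t y - sin_mult t y') ^+ 2) * Cnrm2 (g k)).
Proof.
move=> k0 hP x0 y0 x'0 y'0 Ak A'k.
rewrite (wave_sol_proj f g t k0 hP x0 y0 Ak) (wave_sol_proj f g t k0 hP x'0 y'0 A'k).
rewrite opprD addrACA -!mulmxBl -!toCB !proj_combB.
apply: le_trans (Cnrm2D _ _) _; rewrite ler_wpM2l //.
by apply: lerD; apply: Cnrm2_proj_comb => //; rewrite ?lerDl ?lerDr sqr_ge0.
Qed.

Lemma wave_sol_cvg (R : realType) (n : nat) (T : Type) (F : set_system T)
    (A : T -> 'cV[int]_n -> 'M[R]_n) (A' : 'cV[int]_n -> 'M[R]_n)
    (f g : pdistr R n) (t x' y' : R) (x y : T -> R) (k : 'cV[int]_n) (P : 'M[R]_n) :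
  Filter F -> k != 0 -> is_proj P -> 0 < x' -> 0 < y' ->
  A' k = proj_comb P (- x') (- y') ->
  (\forall d \near F, [/\ 0 < x d, 0 < y d & A d k = proj_comb P (- x d) (- y d)]) ->
  x d @[d --> F] --> x' -> y d @[d --> F] --> y' ->
  Cnrm2 (wave_sol (A d) f g t k - wave_sol A' f g t k) @[d --> F] --> 0.
Proof.
move=> FF k0 hP x'0 y'0 A'k hA xc yc.
pose B d := 2 * (((cos_mult t (x d) - cos_mult t x') ^+ 2
    + (cos_mult t (y d) - cos_mult t y') ^+ 2) * Cnrm2 (f k)
  + ((sin_mult t (x d) - sin_mult t x') ^+ 2
    + (sin_mult t (y d) - sin_mult t y') ^+ 2) * Cnrm2 (g k)).
have sq (z : T -> R) (h : R -> R) (l : R) : {for l, continuous h} ->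
    z d @[d --> F] --> l -> (h (z d) - h l) ^+ 2 @[d --> F] --> 0.
  move=> hl zl; have hz : (h (z d) - h l) @[d --> F] --> 0.
    rewrite -(subrr (h l)); apply: cvgB; last exact: cvg_cst.
    exact: (cvg_comp _ _ zl hl).
  by rewrite -(mulr0 (0 : R)); under eq_fun do rewrite expr2; apply: cvgM.
have Bc : B d @[d --> F] --> 0.
  have -> : 0 = 2 * ((0 + 0) * Cnrm2 (f k) + (0 + 0) * Cnrm2 (g k)) :> R by ring.
  apply: cvgM; first exact: cvg_cst.
  apply: cvgD; (apply: cvgM; last exact: cvg_cst); apply: cvgD.
  - exact: (sq _ _ _ (@cos_mult_continuous _ t x')).
  - exact: (sq _ _ _ (@cos_mult_continuous _ t y')).
  - exact: (sq _ _ _ (sin_mult_continuous (t := t) x'0)).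
  - exact: (sq _ _ _ (sin_mult_continuous (t := t) y'0)).
have z0 : (fun=> 0 : R) d @[d --> F] --> (0 : R) by exact: cvg_cst.
refine (squeeze_cvgr _ z0 Bc).
apply: filterS hA => d [x0 y0 Ad]; rewrite Cnrm2_ge0 /=.
exact: (wave_sol_diff f g t k0 hP x0 y0 x'0 y'0 Ad A'k).
Qed.

Theorem theorem19 (R : realType) (n : nat) (mu lam beta s1 s2 : R)
    (f g : pdistr R n) :
  (1 <= n)%N ->
  beta < n%:R + 2 ->
  0 < mu ->
  0 < lam + 2 * mu ->
  (forall (delta : R) (nu : 'cV[R]_n), 0 < delta -> nu != 0 ->
     lambda1 mu lam beta delta nu < 0) ->
  (forall (delta : R) (nu : 'cV[R]_n), 0 < delta -> nu != 0 ->
     lambda2 mu beta delta nu < 0) ->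
  inH s1 f ->
  inH s2 g ->
  let s' := Num.min s1 (s2 + Num.max 0 ((beta - n%:R) / 2)) in
  let s := Num.min s1 (s2 + 1) in
  forall t : R, 0 <= t ->
    [/\ forall delta : R, 0 < delta ->
          inH s' (peri_sol mu lam beta delta f g t),
        inH s (navier_sol mu lam f g t)
      & Hnorm s' (peri_sol mu lam beta delta f g t \- navier_sol mu lam f g t)
          @[delta --> 0^'+] --> 0%E].
Proof.
move=> n0 hb mu0 lm0 l1 l2 hf hg s' s t t0.
have [C' tC' navC] := @navier_decay R n mu lam t mu0 lm0.
have peri (D : R) := peri_decay D n0 hb mu0 lm0 l1 l2 t0.
split.
- move=> delta d0; have [C tC hC] := peri delta.
  by apply: (inH_wave_sol tC (hC delta _)) => //; rewrite d0 lexx.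
- exact: (inH_wave_sol tC' navC).
have [C tC hC] := peri 1.
have C0 := le_trans (sqr_ge0 t) tC; have C'0 := le_trans (sqr_ge0 t) tC'.
pose p := Num.max 0 ((beta - n%:R) / 2); pose M := Num.max C C'.
have tM : t ^+ 2 <= M by rewrite le_max tC.
have M0 := le_trans (sqr_ge0 t) tM.
have near01 : \forall delta \near (0 : R)^'+, 0 < delta <= 1.
  by near=> d; apply/andP; split; near: d;
    [exact: nbhs_right_gt|exact: nbhs_right_le].
have periM delta : 0 < delta <= 1 ->
    wave_decay (@peri_mult R n mu lam beta delta) t M p.
  by move=> /hC; apply: wave_decay_le => //; rewrite le_max lexx.
have navM : wave_decay (@navier_mult R n mu lam) t M p.
  apply: (wave_decay_le C'0 _ _ navC); first by rewrite le_max lexx orbT.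
  by rewrite ge_max ler01 /=; lra.
apply: (Hnorm_cvg0 (D := fun k => 4 * data_bound s1 s2 M f g k)).
- apply: filterS near01 => delta d01 k; rewrite /Hterm.
  apply: le_trans (ler_wpM2l (powR_ge0 _ _) (Cnrm2D _ _)) _.
  have -> : 4 * data_bound s1 s2 M f g k
    = 2 * (data_bound s1 s2 M f g k + data_bound s1 s2 M f g k) by ring.
  rewrite Cnrm2N mulrCA ler_wpM2l // mulrDr.
  by apply: lerD; apply: Hterm_wave_sol => //; exact: periM.
- by move=> k; rewrite mulr_ge0 // data_bound_ge0.
- move=> k; have [->|k0] := eqVneq k 0.
    rewrite (_ : (fun _ => _) = cst 0); first exact: cvg_cst.
    apply/funext => d; rewrite /peri_sol /navier_sol /wave_sol /= eqxx subrr.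
    by rewrite /Cnrm2 big1 // => i _; rewrite mxE /= expr0n addr0.
  have N0 : 0 < nrm2 (toR R k) := lt_le_trans ltr01 (nrm2_toR_ge1 R k0).
  have x0 : 0 < (lam + 2 * mu) * nrm2 (toR R k) by rewrite mulr_gt0.
  have y0 : 0 < mu * nrm2 (toR R k) by rewrite mulr_gt0.
  apply: (@wave_sol_cvg R n R (0 : R)^'+ (@peri_mult R n mu lam beta)
    (@navier_mult R n mu lam) f g t _ _ _ _ k _ _ k0 (ray_proj_is_proj R k0) x0 y0
    (navier_mult_proj mu lam k0) _
    (@lambda1_cvg R n mu lam beta k n0 hb)
    (@lambda2_cvg R n mu beta k n0 hb)).
  apply: filterS near01 => d /andP[d0 _].
  have v0 := toR_neq0 R k0.
  by rewrite !oppr_gt0 l1 // l2 // !opprK.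
- apply: (esum_mulr_lty (a := fun k => (data_bound s1 s2 M f g k)%:E)) => // [k|].
    by rewrite lee_fin data_bound_ge0.
  exact: data_bound_lty.
Unshelve. all: by end_near.
Qed.
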